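(* Let $\Lambda$ be a finitely generated group, and let $\Lambda\curvearrowright X$ be a minimal and expansive action by homeomorphisms on a Cantor space $X$ such that the action of $\mathbb{A}(\Lambda,X)$ on $X$ does not admit any compressible open subset. Let $\Gamma$ be a subgroup of $\mathbb{F}(\Lambda,X)$ that contains $\mathbb{A}(\Lambda,X)$. Then every commensurated subgroup of $\Gamma$ is either finite or contains $\mathbb{A}(\Lambda,X)$.
   Context: The topological full group $\mathbb{F}(\Lambda,X)$ is the group of homeomorphisms $g$ of $X$ such that for every $x\in X$ there exist a neighbourhood $U$ of $x$ and $\gamma\in\Lambda$ with $g(y)=\gamma(y)$ for all $y\in U$. Given a non-empty clopen $U\subseteq X$ and $\gamma_1,\dots,\gamma_n\in\Lambda$ such that $\gamma_1(U),\dots,\gamma_n(U)$ are pairwise disjoint, there is an injective homomorphism $\mathrm{Sym}(n)\to\mathbb{F}(\Lambda,X)$, $\sigma\mapsto g_\sigma$, with $g_\sigma(x)=\gamma_{\sigma(i)}\gamma_i^{-1}(x)$ if $x\in\gamma_i(U)$ and $g_\sigma(x)=x$ if $x\notin\bigcup_i\gamma_i(U)$. The alternating full group $\mathbb{A}(\Lambda,X)$ is the subgroup of $\mathbb{F}(\Lambda,X)$ generated by the images of the alternating groups $\mathrm{Alt}(n)$ under all such homomorphisms. The action $\Lambda\curvearrowright X$ is expansive if there exist a compatible metric $d$ on $X$ and $\delta>0$ such that for all $x\neq y$ in $X$ there is $\gamma\in\Lambda$ with $d(\gamma(x),\gamma(y))\ge\delta$. For a group $\Delta$ acting on $X$, a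 non-empty open $U\subseteq X$ is compressible if there exists $x\in X$ such that for every neighbourhood $V$ of $x$ there is $\gamma\in\Delta$ with $\gamma(U)\subset V$. Two subgroups are commensurate if their intersection has finite index in both; a subgroup of $\Gamma$ is commensurated if all its $\Gamma$-conjugates are commensurate to one another. *)

(* Defs.v *)
From HB Require Import structures.
From mathcomp Require Import all_boot all_order all_algebra all_fingroup.
From mathcomp Require Import alt.
From mathcomp Require Import all_classical all_reals topology cantor.

Set Implicit Arguments.
Unset Strict Implicit.
Unset Printing Implicit Defensive.

Import Order.TTheory GRing.Theory Num.Theory.

Local Open Scope classical_set_scope.
Local Open Scope group_scope.

(** * Abstract groups; subgroups are predicates on the ambient group *)

Section Groups.
Variable G : groupType.
Implicit Types (A H L Gamma : set G).

Definition subgroup H : Prop := group_closed (mem H).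

Lemma subgroupP H :
  subgroup H <-> H 1 /\ (forall x y, H x -> H y -> H (x * y^-1)).
Proof.
split=> -[H1 HD]; split; do ?[exact: mem_set].
- exact: set_mem H1.
- by move=> x y Hx Hy; apply: set_mem; apply: HD; apply: mem_set.
- by move=> x y /set_mem Hx /set_mem Hy; apply: mem_set; apply: HD.
Qed.

Definition generated A : set G := smallest subgroup A.

Definition fin_gen : Prop := exists2 S, finite_set S & generated S = setT.

Definition lcoset_of L (x : G) : set G := [set x * l | l in L].

(** [L] is intended to be a subgroup of [H]: there are finitely many cosets
    [x L] with [x] in [H]. *)
Definition finite_index H L : Prop := finite_set (lcoset_of L @` H).

Definition commensurate H L : Prop :=
  finite_index H (H `&` L) /\ finite_index L (H `&` L).

Definition conjugate (g : G) H : set G := [set g * h * g^-1 | h in H].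

Definition commensurated Gamma H : Prop :=
  forall a b, Gamma a -> Gamma b ->
    commensurate (conjugate a H) (conjugate b H).

End Groups.

Arguments fin_gen G : clear implicits.

(** * The group of self-homeomorphisms of a topological space *)

Record homeo (X : topologicalType) := Homeo {
  homeo_fun :> X -> X;
  homeo_inv : X -> X;
  homeo_funK : cancel homeo_fun homeo_inv;
  homeo_invK : cancel homeo_inv homeo_fun;
  homeo_fun_cont : continuous homeo_fun;
  homeo_inv_cont : continuous homeo_inv }.

Section HomeoGroup.
Variable X : topologicalType.
Implicit Types f g h : homeo X.

HB.instance Definition _ := gen_eqMixin (homeo X).
HB.instance Definition _ := gen_choiceMixin (homeo X).

Lemma homeo_eq f g : f =1 g -> f = g.
Proof.
case: f g => [f f' fK f'K fc f'c] [g g' gK g'K gc g'c] /= /funext fg.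
have fg' : f' = g' by apply/funext => x; rewrite -[in LHS](g'K x) -fg fK.
subst g g'; congr Homeo; exact: Prop_irrelevance.
Qed.

Fact id_cont : continuous (@id X).
Proof. by move=> x; apply: cvg_id. Qed.

Definition homeo1 : homeo X :=
  @Homeo X id id (fun=> erefl) (fun=> erefl) id_cont id_cont.

Definition homeoV f : homeo X :=
  Homeo (@homeo_invK X f) (@homeo_funK X f)
        (@homeo_inv_cont X f) (@homeo_fun_cont X f).

(* [f * g] is [f] after [g], so that [homeo X] acts on [X] on the left. *)
Definition homeoM f g : homeo X :=
  Homeo (can_comp (@homeo_funK X f) (@homeo_funK X g))
        (can_comp (@homeo_invK X g) (@homeo_invK X f))
        (fun x => continuous_comp (@homeo_fun_cont X g x)
                                  (@homeo_fun_cont X f (g x)))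
        (fun x => continuous_comp (@homeo_inv_cont X f x)
                                  (@homeo_inv_cont X g (homeo_inv f x))).

Lemma homeoA : associative homeoM.
Proof. by move=> f g h; apply: homeo_eq. Qed.

Lemma homeo1M : left_id homeo1 homeoM.
Proof. by move=> f; apply: homeo_eq. Qed.

Lemma homeoM1 : right_id homeo1 homeoM.
Proof. by move=> f; apply: homeo_eq. Qed.

Lemma homeoVM : left_inverse homeo1 homeoV homeoM.
Proof. by move=> f; apply: homeo_eq => x; apply: homeo_funK. Qed.

Lemma homeoMV : right_inverse homeo1 homeoV homeoM.
Proof. by move=> f; apply: homeo_eq => x; apply: homeo_invK. Qed.

HB.instance Definition _ :=
  isGroup.Build (homeo X) homeoA homeo1M homeoM1 homeoVM homeoMV.

Lemma homeoME f g x : (f * g) x = f (g x). Proof. by []. Qed.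

Lemma homeo1E x : (1 : homeo X) x = x. Proof. by []. Qed.

Lemma homeoVE f x : f^-1 x = homeo_inv f x. Proof. by []. Qed.

End HomeoGroup.

Definition is_cantor_space (X : topologicalType) : Prop :=
  exists (f : X -> cantor_space) (g : cantor_space -> X),
    [/\ cancel f g, cancel g f, continuous f & continuous g].

(** * Actions

    An action of [Lambda] on [X] by homeomorphisms is a group morphism from
    [Lambda] to [homeo X]; it need not be faithful. *)

Section Actions.
Variables (Lambda : groupType) (X : topologicalType).
Variable rho : {multiplicative Lambda -> homeo X}.

Lemma action1 : rho 1 = 1.
Proof. by apply: (mulgI (rho 1)); rewrite -gmulfM !mulg1. Qed.

Definition minimal_action : Prop :=
  forall x : X, dense [set rho gamma x | gamma in [set: Lambda]].

Definition is_metric (R : realType) (d : X -> X -> R) : Prop :=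
  [/\ forall x y, (0 <= d x y)%R,
      forall x y, d x y = 0%R <-> x = y,
      forall x y, d x y = d y x &
      forall x y z, (d x z <= d x y + d y z)%R].

Definition compatible_metric (R : realType) (d : X -> X -> R) : Prop :=
  is_metric d /\
  forall (x : X) (A : set X), nbhs x A <->
    exists2 e : R, (0 < e)%R & [set y | (d x y < e)%R] `<=` A.

Definition expansive_action (R : realType) : Prop :=
  exists2 d : X -> X -> R, compatible_metric d &
  exists2 delta : R, (0 < delta)%R &
    forall x y, x <> y ->
      exists gamma, (delta <= d (rho gamma x) (rho gamma y))%R.

Definition full_group : set (homeo X) :=
  [set g | forall x : X, exists2 U : set X, nbhs x U &
           exists gamma, forall y, U y -> g y = rho gamma y].

Section PermHomeo.
Variables (n : nat) (U : set X) (gamma : 'I_n -> Lambda).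

Definition translates_disjoint : Prop :=
  trivIset [set: 'I_n] (fun i => rho (gamma i) @` U).

(** [g] is the homeomorphism g_sigma permuting the translates of [U]; it exists
    and is unique by [is_perm_homeo_ex] and [is_perm_homeo_uniq] below.
    Since the product of ['S_n] is [(s * t) i = t (s i)], the map
    sigma |-> g_sigma reverses products; the image of the subgroup
    ['Alt_('I_n)] is not affected. *)
Definition is_perm_homeo (sigma : 'S_n) (g : homeo X) : Prop :=
  (forall i x, (rho (gamma i) @` U) x ->
     g x = rho (gamma (sigma i) * (gamma i)^-1) x) /\
  (forall x, ~ (\bigcup_i (rho (gamma i) @` U)) x -> g x = x).

Lemma is_perm_homeo_uniq sigma g h :
  is_perm_homeo sigma g -> is_perm_homeo sigma h -> g = h.
Proof.
move=> [g1 g2] [h1 h2]; apply: homeo_eq => x.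
have [[i _ Ux]|nUx] := pselect ((\bigcup_i (rho (gamma i) @` U)) x).
  by rewrite (g1 i) // (h1 i).
by rewrite g2 // h2.
Qed.

Let tile i : set X := rho (gamma i) @` U.

Let perm_fun (sigma : 'S_n) (x : X) : X :=
  if [pick i | `[< tile i x >]] is Some i
  then rho (gamma (sigma i) * (gamma i)^-1) x else x.

Let perm_fun_in : translates_disjoint -> forall sigma i x, tile i x ->
  perm_fun sigma x = rho (gamma (sigma i) * (gamma i)^-1) x.
Proof.
move=> disjU sigma i x tx; rewrite /perm_fun.
case: pickP => [j /asboolP tjx|/(_ i)/asboolP//].
by rewrite (disjU j i) //; exists x.
Qed.

Let perm_fun_out sigma x : (forall i, ~ tile i x) -> perm_fun sigma x = x.
Proof. by move=> nt; rewrite /perm_fun; case: pickP => // i /asboolP /nt. Qed.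

Let tileE i x : tile i x <-> U (rho (gamma i)^-1 x).
Proof.
split=> [[y Uy <-]|Ux].
  by rewrite -homeoME -gmulfM mulVg action1.
by exists (rho (gamma i)^-1 x); rewrite // -homeoME -gmulfM mulgV action1.
Qed.

Let tile_move i j x : tile i x -> tile j (rho (gamma j * (gamma i)^-1) x).
Proof.
move=> /tileE tx; exists (rho (gamma i)^-1 x) => //.
by rewrite gmulfM.
Qed.

Let tile_clopen : clopen U -> forall i, clopen (tile i).
Proof.
move=> [oU cU] i.
have -> : tile i = rho (gamma i)^-1 @^-1` U by apply/seteqP; split=> x /tileE.
split.
- by apply: open_comp => // x _; apply: homeo_fun_cont.
- by apply: preimage_closed => // x _; apply: homeo_fun_cont.
Qed.

Let perm_funK : translates_disjoint ->
  forall sigma, cancel (perm_fun sigma) (perm_fun sigma^-1).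
Proof.
move=> disjU sigma x.
have [[i tx]|/forallNP nt] := pselect (exists i, tile i x).
  rewrite (perm_fun_in disjU sigma tx).
  rewrite (perm_fun_in disjU _ (tile_move (sigma i) tx)) permK.
  by rewrite -homeoME -gmulfM -mulgA mulKg mulgV action1.
by rewrite !(perm_fun_out _ nt).
Qed.

Let perm_fun_cont : clopen U -> translates_disjoint ->
  forall sigma, continuous (perm_fun sigma).
Proof.
move=> clU disjU sigma x.
have local (W : set X) (g : homeo X) : nbhs x W ->
    (forall y, W y -> g y = perm_fun sigma y) ->
    {for x, continuous (perm_fun sigma)}.
  move=> xW Wg; rewrite /prop_for /continuous_at -Wg; last exact: nbhs_singleton.
  have gx := @homeo_fun_cont _ g x; apply: cvg_trans gx.
  by apply: near_eq_cvg; apply: filterS xW => y; apply: Wg.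
have [[i tx]|/forallNP nt] := pselect (exists i, tile i x).
  apply: (local (tile i) (rho (gamma (sigma i) * (gamma i)^-1))).
    by apply: open_nbhs_nbhs; split=> //; case: (tile_clopen clU i).
  by move=> y ty; rewrite (perm_fun_in disjU _ ty).
apply: (local [set y | forall i, ~ tile i y] 1).
  apply: filter_forall => i.
  apply: open_nbhs_nbhs; split; last exact: nt.
  by apply: closed_openC; case: (tile_clopen clU i).
by move=> y ty; rewrite perm_fun_out.
Qed.

Lemma is_perm_homeo_ex sigma : clopen U -> translates_disjoint ->
  exists g : homeo X, is_perm_homeo sigma g /\ full_group g.
Proof.
move=> clU disjU.
have invK : cancel (perm_fun sigma^-1) (perm_fun sigma).
  by have := perm_funK disjU (sigma^-1); rewrite invgK.
pose g := Homeo (perm_funK disjU sigma) invK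
  (@perm_fun_cont clU disjU sigma) (@perm_fun_cont clU disjU (sigma^-1)).
exists g; split; first split=> [i x tx|x nt].
- exact: perm_fun_in.
- by apply: perm_fun_out => i ti; apply: nt; exists i.
move=> x; have [[i tx]|/forallNP nt] := pselect (exists i, tile i x).
  exists (tile i).
    by apply: open_nbhs_nbhs; split=> //; case: (tile_clopen clU i).
  by exists (gamma (sigma i) * (gamma i)^-1) => y ty; apply: perm_fun_in.
exists [set y | forall i, ~ tile i y].
  apply: filter_forall => i.
  apply: open_nbhs_nbhs; split; last exact: nt.
  by apply: closed_openC; case: (tile_clopen clU i).
by exists 1 => y ty; rewrite action1; apply: perm_fun_out.
Qed.
End PermHomeo.

Definition alternating_generators : set (homeo X) :=
  [set g | exists n (U : set X) (gamma : 'I_n -> Lambda),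
     [/\ U !=set0, clopen U, translates_disjoint U gamma &
      exists2 sigma, sigma \in 'Alt_('I_n) & is_perm_homeo U gamma sigma g]].

Definition alternating_full_group : set (homeo X) :=
  generated alternating_generators.

End Actions.

Definition compressible (X : topologicalType) (Delta : set (homeo X))
    (U : set X) : Prop :=
  [/\ U !=set0, open U &
   exists x : X, forall V, nbhs x V -> exists2 g, Delta g & g @` U `<=` V].

(* Main.v *)
Require Import Defs.
From HB Require Import structures.
From mathcomp Require Import all_boot all_order all_algebra all_fingroup.
From mathcomp Require Import all_classical all_reals topology.
From mathcomp Require Import alt cantor.

Set Implicit Arguments.
Unset Strict Implicit.
Unset Printing Implicit Defensive.

Local Open Scope classical_set_scope.
Local Open Scope group_scope.

(** Let A be the alternating full group and L = K /\ A, which A commensurates.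
    A is simple, finitely generated, has trivial centraliser in the
    homeomorphism group, and is normal in the full group. The last three facts
    show that K is finite as soon as L is ([finite_of_finite_trace]), so the
    question is whether an infinite L that does not contain A produces a
    compressible open set ([commensurated_alt]).

    The finite index subgroups of L form a base of neighbourhoods of 1 for a
    group topology on A. Let R be the closed relation on X formed by the limits
    of pairs (x, h x) with h tending to 1. It is A-invariant, and A moves any
    pair of distinct points close to any other pair, so R is either the diagonal
    or everything ([uniform_or_transitive]).

    If R is everything, then small elements of L move any open set to meet any
    other, so each element of A is approximated by one that is trivial on some
    open set. As A is finitely generated, finitely many approximations suffice to
    write A = F L with F the fixator of a single clopen set V. Elements supported
    in V commute with F; hence those that lie in L have all their conjugates in
    L and are trivial by simplicity, and the conjugacy class of an element a
    supported in V lies in the finite union L a L of cosets of L and so is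
    finite, which is absurd ([not_locally_transitive]).

    If R is the diagonal, small elements of L are uniformly close to 1, so they
    preserve any given clopen set. Their commutators with elements supported in
    a clopen set U are then supported in U, and L contains non-trivial elements
    with arbitrarily small support. The uniform closure L' of L is commensurated,
    clopen sets have finite L'-orbits, and therefore there are finitely many
    non-empty clopen sets such that an element of L' that leaves L' under
    conjugation by one of the generators of A moves every point of one of them.
    By simplicity and finite generation, a non-trivial element of L supported near a
    point x0 has a conjugate of this kind, and undoing the conjugation moves one
    of the finitely many clopen sets near x0. This is a compressible set
    ([uniform_compressible]).

    Finite generation of A ([alt_fin_gen]) is a theorem of Nekrashevych. Its
    proof rests on two facts about 3-cycles over clopen bases: the commutator of
    two of them that share one leg lives over the intersection of the bases, and
    expansiveness means that finitely many clopen sets and their translates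
    generate all clopen sets. *)

(** * Subgroups and finite index *)

Section Subgroups.
Variable G : groupType.
Implicit Types (H L M A : set G) (g h k : G).

Lemma subgroup1 H : subgroup H -> H 1.
Proof. by move=> /subgroupP[]. Qed.

Lemma subgroupV H g : subgroup H -> H g -> H g^-1.
Proof. by move=> /subgroupP[H1 HB] Hg; rewrite -[g^-1]mul1g; apply: HB. Qed.

Lemma subgroupM H g h : subgroup H -> H g -> H h -> H (g * h).
Proof.
move=> sH Hg Hh; rewrite -[h]invgK.
by case/subgroupP: (sH) => _; apply=> //; apply: subgroupV.
Qed.

Lemma subgroup_intro H : H 1 -> (forall g h, H g -> H h -> H (g * h)) ->
  (forall g, H g -> H g^-1) -> subgroup H.
Proof.
by move=> H1 HM HV; apply/subgroupP; split=> // g h Hg Hh; apply/HM/HV.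
Qed.

Lemma subgroupI H M : subgroup H -> subgroup M -> subgroup (H `&` M).
Proof.
move=> sH sM; apply: subgroup_intro => [|g h [Hg Mg] [Hh Mh]|g [Hg Mg]].
- by split; apply: subgroup1.
- by split; apply: subgroupM.
- by split; apply: subgroupV.
Qed.

Lemma subgroup_conj H g : subgroup H -> subgroup [set x | H (g^-1 * x * g)].
Proof.
move=> sH; apply: subgroup_intro => [|x y Hx Hy|x Hx] /=.
- by rewrite mulg1 mulVg; apply: subgroup1.
- rewrite (_ : _ * _ * _ = (g^-1 * x * g) * (g^-1 * y * g)).
    exact: subgroupM.
  by rewrite !mulgA mulgK.
- rewrite (_ : _ * _ * _ = (g^-1 * x * g)^-1); first exact: subgroupV.
  by rewrite !invgM invgK mulgA.
Qed.

Lemma subgroup_centralizer g : subgroup [set x : G | x * g = g * x].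
Proof.
apply: subgroup_intro => [|x y /= xg yg|x /= xg]; first by rewrite /= mul1g mulg1.
  by rewrite -mulgA yg !mulgA xg.
by apply: (mulgI x); rewrite mulVKg mulgA xg mulgK.
Qed.

Lemma generatedS A : A `<=` Defs.generated A.
Proof. by move=> x Ax H [_]; apply. Qed.

Lemma generated_sub A H : subgroup H -> A `<=` H -> Defs.generated A `<=` H.
Proof. by move=> sH AH x; apply. Qed.

Lemma generated_subgroup A : subgroup (Defs.generated A).
Proof.
apply: subgroup_intro => [H [sH _]|x y gx gy H HA|x gx H HA].
- exact: subgroup1.
- by apply: subgroupM; [case: HA|apply: gx|apply: gy].
- by apply: subgroupV; [case: HA|apply: gx].
Qed.

Lemma conjugateE g H x : Defs.conjugate g H x <-> H (g^-1 * x * g).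
Proof.
split=> [[h Hh <-]|Hx]; first by rewrite !mulgA mulVg mul1g mulgKV.
by exists (g^-1 * x * g); rewrite // !mulgA mulgV mul1g mulgK.
Qed.

(** Stated with a list of representatives taken in [H], which makes sense for
    subsets [H] and [M] that are not subgroups. *)
Definition fin_cover H M : Prop :=
  exists ks : seq G, (forall k, k \in ks -> H k) /\
    forall h, H h -> exists2 k, k \in ks & M (k^-1 * h).

(** Finite index is always established by colouring: elements of [H] with a
    common colour lie in the same left coset of [M]. *)
Lemma fin_cover_color (T : eqType) (cs : seq T) (R : G -> T -> Prop) H M :
  (forall h, H h -> exists2 c, c \in cs & R h c) ->
  (forall h h' c, H h -> H h' -> R h c -> R h' c -> M (h^-1 * h')) ->
  fin_cover H M.
Proof.
move=> Hcs RM.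
suff [ks [Hks cov]] : exists ks : seq G, (forall k, k \in ks -> H k) /\
    forall h c, H h -> c \in cs -> R h c -> exists2 k, k \in ks & M (k^-1 * h).
  exists ks; split=> // h Hh; have [c ccs Rhc] := Hcs h Hh.
  exact: cov Hh ccs Rhc.
elim: cs {Hcs} => [|c cs [ks [Hks cov]]]; first by exists [::]; split.
have [[k [Hk Rk]]|nk] := pselect (exists k, H k /\ R k c).
  exists (k :: ks); split=> [k'|h d Hh].
    by rewrite inE => /predU1P[->|]; [|apply: Hks].
  rewrite inE => /predU1P[-> Rh|dcs Rh].
    by exists k; [rewrite mem_head|apply: RM Rk Rh].
  have [k' k'ks Mk'] := cov h d Hh dcs Rh.
  by exists k'; rewrite // inE k'ks orbT.
exists ks; split=> // h d Hh; rewrite inE => /predU1P[-> Rh|]; last exact: cov.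
by case: nk; exists h.
Qed.

Lemma finite_index_cover H M K : subgroup M -> K `<=` H -> subgroup K ->
  finite_index H M -> fin_cover K (K `&` M).
Proof.
move=> sM KH sK /finite_seqP[cs csE].
apply: (@fin_cover_color _ cs (fun h c => lcoset_of M h = c)) => [h Kh|].
  by exists (lcoset_of M h) => //; have : [set` cs] (lcoset_of M h);
     [rewrite -csE; exists h => //; apply: KH|].
move=> h h' c Kh Kh' <- ch'; split.
  by apply: subgroupM => //; apply: subgroupV.
have : lcoset_of M h' h' by exists 1; [apply: subgroup1|rewrite mulg1].
by rewrite ch' => -[m Mm <-]; rewrite mulKg.
Qed.

Lemma fin_coverI H M N : subgroup M -> subgroup N ->
  fin_cover H M -> fin_cover H N -> fin_cover H (M `&` N).
Proof.
move=> sM sN [ks [Hks cM]] [ls [Hls cN]].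
apply: (@fin_cover_color _ [seq (k, l) | k <- ks, l <- ls]
  (fun h c => M (c.1^-1 * h) /\ N (c.2^-1 * h))) => [h Hh|h h' c _ _].
  have [k kks Mk] := cM h Hh; have [l lls Nl] := cN h Hh.
  by exists (k, l) => //; apply/allpairsP; exists (k, l).
move=> [Mh Nh] [Mh' Nh'].
have E x : h^-1 * h' = (x^-1 * h)^-1 * (x^-1 * h').
  by rewrite invgM invgK mulgA mulgK.
split; first by rewrite (E c.1); apply: subgroupM => //; apply: subgroupV.
by rewrite (E c.2); apply: subgroupM => //; apply: subgroupV.
Qed.

Lemma fin_cover_trans H M N :
  subgroup H -> M `<=` H -> fin_cover H M -> fin_cover M N -> fin_cover H N.
Proof.
move=> sH MH [ks [Hks cM]] [ls [Mls cN]].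
exists [seq k * l | k <- ks, l <- ls]; split=> [x /allpairsP[[k l] /=]|h Hh].
  by move=> [/Hks Hk /Mls/MH Hl ->]; apply: subgroupM.
have [k kks Mk] := cM h Hh; have [l lls Nl] := cN _ Mk.
exists (k * l); first by apply/allpairsP; exists (k, l).
by rewrite invgM -mulgA.
Qed.

Lemma fin_coverS H M N : M `<=` N -> fin_cover H M -> fin_cover H N.
Proof.
move=> MN [ks [Hks cM]]; exists ks; split=> // h /cM[k kks /MN Nk].
by exists k.
Qed.

Lemma fin_cover1_finite H : fin_cover H [set 1] -> finite_set H.
Proof.
move=> [ks [_ cov]]; apply: (@sub_finite_set _ _ [set` ks]) => [h /cov|].
  by move=> [k kks /= /(canRL (mulVKg _))]; rewrite mulg1 => ->.
exact: finite_seq.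
Qed.

(** For a commensurated subgroup [L], these are a base of neighbourhoods of the
    identity for a group topology on the group that commensurates [L]. *)
Definition open_in L M : Prop := [/\ subgroup M, M `<=` L & fin_cover L M].

Lemma open_in_refl L : subgroup L -> open_in L L.
Proof.
move=> sL; split=> //; exists [:: 1]; split=> [k|h Lh].
  by rewrite inE => /eqP ->; apply: subgroup1.
by exists 1; rewrite ?mem_head // invg1 mul1g.
Qed.

Lemma open_inI L M N : open_in L M -> open_in L N -> open_in L (M `&` N).
Proof.
move=> [sM ML cM] [sN NL cN]; split; first exact: subgroupI.
- by move=> x [/ML].
- exact: fin_coverI.
Qed.

(** The index is finite because the cosets of [M] that contain [a^-1 h a] colour
    the elements [h] of [L] that [a^-1] conjugates into [L]. *)
Lemma open_in_conj A L M : subgroup L ->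
  (forall a, A a -> fin_cover L (L `&` Defs.conjugate a L)) ->
  forall a, A a -> open_in L M ->
    open_in L (M `&` [set x | M (a^-1 * x * a)]).
Proof.
move=> sL comL a Aa [sM ML cM]; split; first exact/subgroupI/subgroup_conj.
- by move=> x [/ML].
apply: fin_coverI => //; first exact: subgroup_conj.
pose La : set G := L `&` Defs.conjugate a L.
apply: (@fin_cover_trans _ La) => //; [by move=> x []|exact: comL|].
case: cM => ks [_ cM].
apply: (@fin_cover_color _ ks (fun h k => M (k^-1 * (a^-1 * h * a)))).
  by move=> h [_ /conjugateE Lh]; apply: cM.
move=> h h' k _ _ Mh Mh' /=.
rewrite (_ : _ * _ = (k^-1 * (a^-1 * h * a))^-1 * (k^-1 * (a^-1 * h' * a))).
  by apply: subgroupM => //; apply: subgroupV.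
by rewrite !invgM !invgK !mulgA !mulgK.
Qed.

End Subgroups.

(** * Clopen sets of Cantor spaces *)

Section Clopen.
Variable X : topologicalType.
Implicit Types (U V W N : set X) (x y z : X).

Lemma clopen0 : clopen (set0 : set X).
Proof. by split; [apply: open0|apply: closed0]. Qed.

Lemma clopenX : clopen [set: X].
Proof. by split; [apply: openT|apply: closedT]. Qed.

Lemma clopen_setI U V : clopen U -> clopen V -> clopen (U `&` V).
Proof. by move=> [oU cU] [oV cV]; split; [apply: openI|apply: closedI]. Qed.

Lemma clopen_setU U V : clopen U -> clopen V -> clopen (U `|` V).
Proof. by move=> [oU cU] [oV cV]; split; [apply: openU|apply: closedU]. Qed.

Lemma clopen_setC U : clopen U -> clopen (~` U).
Proof. by move=> [oU cU]; split; [rewrite openC|rewrite closedC]. Qed.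

Lemma clopen_setD U V : clopen U -> clopen V -> clopen (U `\` V).
Proof. by move=> cU cV; apply: clopen_setI => //; apply: clopen_setC. Qed.

Lemma clopen_preim (h : homeo X) U : clopen U -> clopen [set x | U (h x)].
Proof.
move=> [oU cU]; split.
- by apply: open_comp => // x _; apply: homeo_fun_cont.
- by apply: preimage_closed => // x _; apply: homeo_fun_cont.
Qed.

(** Properties of small clopen sets are stated for all clopen subsets of some
    clopen neighbourhood of a point, so that finitely many of them can be imposed
    together. *)
Lemma local_clopenI (P Q : set X -> Prop) x :
  (exists2 N, clopen N /\ N x & forall V, clopen V -> V `<=` N -> P V) ->
  (exists2 N, clopen N /\ N x & forall V, clopen V -> V `<=` N -> Q V) ->
  exists2 N, clopen N /\ N x &
    forall V, clopen V -> V `<=` N -> P V /\ Q V.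
Proof.
move=> [N [cN Nx] PN] [M [cM Mx] QM]; exists (N `&` M).
  by split; [apply: clopen_setI|split].
move=> V cV VNM; split.
- by apply: PN => // y /VNM[].
- by apply: QM => // y /VNM[].
Qed.

Lemma local_clopen_all (T : eqType) (s : seq T) (P : T -> set X -> Prop) x :
  (forall t, t \in s ->
    exists2 N, clopen N /\ N x & forall V, clopen V -> V `<=` N -> P t V) ->
  exists2 N, clopen N /\ N x &
    forall V, clopen V -> V `<=` N -> forall t, t \in s -> P t V.
Proof.
elim: s => [|t s IHs] Ps.
  by exists setT => //; split=> //; apply: clopenX.
have [|N Nx PN] := local_clopenI (Ps t (mem_head _ _)) (IHs _).
  by move=> u us; apply: Ps; rewrite inE us orbT.
exists N => // V cV /PN-/(_ cV)[Pt Ps'] u.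
by rewrite inE => /predU1P[->//|]; apply: Ps'.
Qed.

End Clopen.

Section CantorSpace.
Variable X : topologicalType.
Hypothesis X_cantor : is_cantor_space X.
Implicit Types (U V W N : set X) (x y z : X).

Lemma cantor_finite_cover (N : X -> set X) :
  (forall x, open (N x) /\ N x x) ->
  exists xs : seq X, forall y, exists2 x, x \in xs & N x y.
Proof.
move=> oN; case: X_cantor => f [g [fK gK cf cg]].
have := cantor_space_compact.
rewrite (@compact_cover cantor_space).
case/(_ cantor_space setT (fun c => g @^-1` N (g c))) => [c _|c _|D _ cov].
- by apply: open_comp => [x _|]; [apply: cg|apply: (oN _).1].
- by exists c => //; apply: (oN _).2.
exists [seq g c | c <- finmap.enum_fset D] => y.
have [c /= cD /=] := cov (f y) I; rewrite fK => Ny.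
by exists (g c) => //; apply: map_f.
Qed.

Lemma cantor_clopen_sep x y : x <> y -> exists U, [/\ clopen U, U x & ~ U y].
Proof.
move=> xy; case: X_cantor => f [g [fK gK cf cg]].
have [|U [[oU cU] Ux Uy]] := @cantor_zero_dimensional (f x) (f y).
  by apply/eqP => /(can_inj fK).
exists (f @^-1` U); split=> //; split.
- by apply: open_comp => // z _; apply: cf.
- by apply: preimage_closed => // z _; apply: cf.
Qed.

Lemma cantor_clopen_basis x V : nbhs x V ->
  exists2 U, clopen U /\ U x & U `<=` V.
Proof.
rewrite nbhsE => -[W [oW Wx] WV].
have sep y : exists U, [/\ clopen U, U x & y = x \/ ~ U y].
  have [->|yx] := pselect (y = x).
    by exists setT; split; [apply: clopenX| |left].
  have [|U [cU Ux Uy]] := @cantor_clopen_sep x y; first by move/esym.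
  by exists U; split=> //; right.
have [B BP] := choice sep.
pose N y : set X := [set z | (W y /\ W z) \/ (~ W y /\ ~ B y z)].
have oN y : open (N y) /\ N y y.
  have [Wy|nWy] := pselect (W y); split; rewrite /N /=.
  - by rewrite (_ : [set _ | _] = W) //; apply/seteqP; split=> z /= => [[[]|[]]|]; auto.
  - by left.
  - rewrite (_ : [set _ | _] = ~` B y); last first.
      by apply/seteqP; split=> z /= => [[[]|[]]|]; auto.
    by rewrite openC; case: (BP y) => -[].
  - by right; split=> // Byy; case: (BP y) => _ _ [yx|]//; apply: nWy; rewrite yx.
have [ys cov] := cantor_finite_cover oN.
suff [U [cU Ux UB]] : exists U, [/\ clopen U, U x &
    forall y, y \in ys -> U `<=` B y].
  exists U => // z Uz; apply: WV.
  by have [y yys [[]|[_]]] := cov z => //; case; apply: UB Uz.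
elim: ys {cov} => [|y ys [U [cU Ux UB]]].
  by exists setT; split=> //; apply: clopenX.
case: (BP y) => cB Bx _; exists (U `&` B y); split=> //.
  exact: clopen_setI.
by move=> z; rewrite inE => /predU1P[-> w []|/UB Bz w [/Bz]].
Qed.

Lemma cantor_open_infinite U x (s : seq X) : open U -> U x ->
  exists2 y, U y & y \notin s.
Proof.
elim: s U x => [|a s IHs] U x oU Ux; first by exists x.
have [y Uy ya] : exists2 y, U y & y <> a.
  have [xa|] := pselect (x = a); last by exists x.
  case: X_cantor => f [g [fK gK cf cg]].
  have : limit_point [set: cantor_space] (f x).
    by case: cantor_perfect => _ ->.
  have nbU : nbhs (f x) (g @^-1` U).
    by apply: cg; rewrite /= fK; apply: open_nbhs_nbhs.
  move=> /(_ _ nbU)[c [cx _ Uc]]; exists (g c) => // gca.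
  by move/eqP: cx; apply; rewrite xa -gca gK.
have [W [[oW _] Wy nWa]] := cantor_clopen_sep ya.
have [z [Uz Wz] zs] := IHs _ y (openI oU oW) (conj Uy Wy).
exists z => //; rewrite inE negb_or zs andbT.
by apply/eqP => za; apply: nWa; rewrite -za.
Qed.

(** The working form of compactness: a property of clopen sets that is stable
    under disjoint unions holds for all of them once it holds for the small
    ones. *)
Lemma cantor_clopen_ind (P : set X -> Prop) :
  P set0 ->
  (forall U V, clopen U -> clopen V -> U `&` V = set0 -> P U -> P V ->
    P (U `|` V)) ->
  (forall x, exists2 N, clopen N /\ N x &
    forall V, clopen V -> V `<=` N -> P V) ->
  forall U, clopen U -> P U.
Proof.
move=> P0 PU loc.
have /choice[N NP] x : exists N, [/\ clopen N, N x &
    forall V, clopen V -> V `<=` N -> P V].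
  by have [N [cN Nx] PN] := loc x; exists N.
have [|xs cov] := @cantor_finite_cover N.
  by move=> x; case: (NP x) => -[].
suff: forall (xs : seq X) U, clopen U -> (forall y, U y -> exists2 x, x \in xs & N x y) ->
    P U by move=> H U cU; apply: H cU _ => y _; apply: cov.
elim=> [|x {}xs IHxs] U cU {}cov.
  by rewrite (_ : U = set0) // -subset0 => y /cov[].
have [cN Nx PN] := NP x.
rewrite -(setUIDK U (N x)); apply: PU.
- exact: clopen_setI.
- exact: clopen_setD.
- by rewrite -subset0 => y [[_ Ny] [_]].
- by apply: PN; [apply: clopen_setI|apply: subIsetr].
apply: IHxs; first exact: clopen_setD.
move=> y [/cov[z]]; rewrite inE => /predU1P[->//|zxs Nz _].
by exists z.
Qed.

(** The last clause makes the datum carried at a point unique, as well as the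
    piece that contains the point. *)
Lemma cantor_partition (T : eqType) (R : set X -> T -> Prop) :
  (forall x, exists t, exists2 N, clopen N /\ N x &
    forall V, clopen V -> V `<=` N -> R V t) ->
  exists ps : seq (set X * T),
    [/\ forall p, p \in ps -> clopen p.1 /\ R p.1 p.2,
        forall x, exists2 p, p \in ps & p.1 x &
        forall p q x, p \in ps -> q \in ps -> p.1 x -> q.1 x -> p = q].
Proof.
move=> loc.
pose P U := exists ps : seq (set X * T),
    [/\ forall p, p \in ps -> [/\ clopen p.1, R p.1 p.2 & p.1 `<=` U],
        forall x, U x -> exists2 p, p \in ps & p.1 x &
        forall p q x, p \in ps -> q \in ps -> p.1 x -> q.1 x -> p = q].
suff /(_ setT)[|ps [psR cov inj]] : forall U, clopen U -> P U.
- exact: clopenX.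
- exists ps; split=> // [p /psR[]//|x]; exact: cov.
apply: cantor_clopen_ind => [|U V cU cV UV0|x].
- by exists [::]; split.
- move=> [ps [psR pcov pinj]] [qs [qsR qcov qinj]].
  have dis p q x : p \in ps -> q \in qs -> p.1 x -> ~ q.1 x.
    move=> /psR[_ _ pU] /qsR[_ _ qV] /pU Ux /qV Vx.
    by have : (U `&` V) x by []; rewrite UV0.
  exists (ps ++ qs); split=> [p|x [/pcov|/qcov] [p pin px]|p q x].
  + rewrite mem_cat => /orP[/psR|/qsR] [cp Rp pU]; split=> // y /pU; by [left|right].
  + by exists p; rewrite // mem_cat pin.
  + by exists p; rewrite // mem_cat pin orbT.
  rewrite !mem_cat => /orP[pp|pq] /orP[qp|qq] px qx.
  + exact: pinj pp qp px qx.
  + by case: (dis p q x).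
  + by case: (dis q p x).
  + exact: qinj pq qq px qx.
have [t [N Nx NR]] := loc x; exists N => // V cV VN.
exists [:: (V, t)]; split=> [p|y Vy|p q y].
- by rewrite inE => /eqP ->; split=> //; apply: NR.
- by exists (V, t) => //; rewrite mem_head.
by rewrite !inE => /eqP -> /eqP ->.
Qed.

Lemma partition_glue (T : eqType) (ps : seq (set X * T)) (P : set X -> Prop) V :
  P set0 ->
  (forall U V, clopen U -> clopen V -> U `&` V = set0 -> P U -> P V ->
    P (U `|` V)) ->
  clopen V ->
  (forall p, p \in ps -> clopen p.1) ->
  (forall x, exists2 p, p \in ps & p.1 x) ->
  (forall p q x, p \in ps -> q \in ps -> p.1 x -> q.1 x -> p = q) ->
  (forall p, p \in ps -> P (V `&` p.1)) -> P V.
Proof.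
move=> P0 PU cV cps cov inj PV.
pose B (qs : seq (set X * T)) := V `&` [set x | exists2 p, p \in qs & p.1 x].
suff /(_ ps)[|_ PB] : forall qs, {subset qs <= ps} -> clopen (B qs) /\ P (B qs).
- by [].
- by rewrite (_ : V = B ps) //; apply/seteqP; split=> x => [|[]//]; split.
elim=> [|p qs IHqs] qps.
  by rewrite (_ : B _ = set0); [split=> //; apply: clopen0|
     rewrite -subset0 => x [_ []]].
have [|cB PB] := IHqs; first by move=> q qin; apply: qps; rewrite inE qin orbT.
have pps := qps _ (mem_head _ _).
have [pin|pnin] := boolP (p \in qs).
  suff -> : B (p :: qs) = B qs by [].
  apply/seteqP; split=> x [Vx [q]]; last first.
    by move=> qin qx; split=> //; exists q; rewrite // inE qin orbT.
  by rewrite inE => /predU1P[->|]; split=> //; [exists p|exists q].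
have -> : B (p :: qs) = (V `&` p.1) `|` B qs.
  apply/seteqP; split=> x.
    move=> [Vx [q]]; rewrite inE => /predU1P[-> px|qin qx]; first by left.
    by right; split=> //; exists q.
  move=> [[Vx px]|[Vx [q qin qx]]]; split=> //.
    by exists p; rewrite ?mem_head.
  by exists q; rewrite // inE qin orbT.
have cVp : clopen (V `&` p.1) by apply: clopen_setI => //; apply: cps.
split; first exact: clopen_setU.
apply: PU => //; last exact: PV.
rewrite -subset0 => x [[_ px] [_ [q qin qx]]].
have qps' : q \in ps by apply: qps; rewrite inE qin orbT.
by move/negP: pnin; apply; rewrite (inj p q x pps qps' px qx).
Qed.

End CantorSpace.

(** * 3-cycles over clopen sets *)

Section HomeoBasics.
Variable X : topologicalType.
Implicit Types (g h : homeo X) (x : X).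

Lemma homeoK g x : g^-1 (g x) = x.
Proof. by rewrite homeoVE homeo_funK. Qed.

Lemma homeoKV g x : g (g^-1 x) = x.
Proof. by rewrite homeoVE homeo_invK. Qed.

Lemma homeo_inj g : injective g.
Proof. exact: can_inj (@homeo_funK _ g). Qed.

Lemma homeo_inv_fix g x : g x = x -> g^-1 x = x.
Proof. by move=> gx; apply: (@homeo_inj g); rewrite homeoKV. Qed.

Lemma homeo_neq1 g : g <> 1 -> exists x, g x <> x.
Proof.
move=> g1; have [//|/forallNP nx] := pselect (exists x, g x <> x).
by case: g1; apply: homeo_eq => x; apply: contrapT; apply: nx.
Qed.

End HomeoBasics.

Section ThreeCycles.
Variables (Lambda : groupType) (X : topologicalType).
Variable rho : {multiplicative Lambda -> homeo X}.
Implicit Types (U V W N : set X) (x y z : X) (a b c d e s : Lambda).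
Implicit Types (g h : homeo X) (H : set (homeo X)) (E F : seq Lambda).

Local Notation A := (alternating_full_group rho).

Lemma alt_subgroup : subgroup A.
Proof. exact: generated_subgroup. Qed.

Lemma rho1E x : rho 1 x = x.
Proof. by rewrite action1. Qed.

Lemma rhoME a b x : rho (a * b) x = rho a (rho b x).
Proof. by rewrite gmulfM. Qed.

Lemma rhoK a x : rho a^-1 (rho a x) = x.
Proof. by rewrite -rhoME mulVg rho1E. Qed.

Lemma rhoKV a x : rho a (rho a^-1 x) = x.
Proof. by rewrite -rhoME mulgV rho1E. Qed.

Lemma rho_inj a : injective (rho a).
Proof. exact: can_inj (rhoK a). Qed.

Definition disjoint_legs U a b : Prop :=
  forall y z, U y -> U z -> rho a y <> rho b z.

Lemma disjoint_legsC U a b : disjoint_legs U a b -> disjoint_legs U b a.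
Proof. by move=> dU y z Uy Uz /esym; apply: dU. Qed.

Lemma disjoint_legsS U V a b :
  V `<=` U -> disjoint_legs U a b -> disjoint_legs V a b.
Proof. by move=> VU dU y z /VU Uy /VU; apply: dU. Qed.

Definition disjoint3 U a b c : Prop :=
  [/\ disjoint_legs U a b, disjoint_legs U a c & disjoint_legs U b c].

Lemma disjoint3S U V a b c : V `<=` U -> disjoint3 U a b c -> disjoint3 V a b c.
Proof. by move=> VU [ab ac bc]; split; apply: disjoint_legsS VU _. Qed.

Definition is_tricycle U a b c g : Prop :=
  [/\ forall y, U y -> g (rho a y) = rho b y,
      forall y, U y -> g (rho b y) = rho c y,
      forall y, U y -> g (rho c y) = rho a y &
      forall x, (forall y, U y ->
        [/\ x <> rho a y, x <> rho b y & x <> rho c y]) -> g x = x].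

Lemma is_tricycle_uniq U a b c g h :
  is_tricycle U a b c g -> is_tricycle U a b c h -> g = h.
Proof.
move=> [ga gb gc g1] [ha hb hc h1]; apply: homeo_eq => x.
have [[y [Uy]]|nx] := pselect (exists y, U y /\
    (x = rho a y \/ x = rho b y \/ x = rho c y)).
  by case=> [->|[->|->]]; rewrite ?ga ?ha ?gb ?hb ?gc ?hc.
by rewrite g1 ?h1 // => y Uy; split=> xy; apply: nx; exists y; auto.
Qed.

(** The 3-cycle [aU -> bU -> cU -> aU]; the default value [1] makes it an
    element of the alternating full group without any condition. *)
Definition tricycle U a b c : homeo X :=
  xget 1 [set g | [/\ clopen U, disjoint3 U a b c & is_tricycle U a b c g]].

Lemma is_tricycle_ex U a b c : clopen U -> disjoint3 U a b c ->
  exists2 g, A g & is_tricycle U a b c g.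
Proof.
move=> cU [ab ac bc].
have [U0|/set0P U0] := eqVneq U set0.
  exists 1; first exact: subgroup1 alt_subgroup.
  by split=> [y|y|y|x _]; [rewrite U0|rewrite U0|rewrite U0|].
pose gamma (i : 'I_3) := nth a [:: a; b; c] i.
have disjU : translates_disjoint rho U gamma.
  move=> i j _ _ [x [[y Uy <-] [z Uz]]]; rewrite /gamma.
  case: i => -[|[|[|//]]] li; case: j => -[|[|[|//]]] lj /= E;
    do ?[exact/val_inj]; exfalso; move: E.
  - exact: disjoint_legsC ab _ _ Uz Uy.
  - exact: disjoint_legsC ac _ _ Uz Uy.
  - exact: ab.
  - exact: disjoint_legsC bc _ _ Uz Uy.
  - exact: ac.
  - exact: bc.
pose o0 : 'I_3 := Ordinal (isT : (0 < 3)%N).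
pose o1 : 'I_3 := Ordinal (isT : (1 < 3)%N).
pose o2 : 'I_3 := Ordinal (isT : (2 < 3)%N).
pose sigma : 'S_3 := (tperm o0 o1 * tperm o0 o2)%g.
have [g [[gin gout] _]] := is_perm_homeo_ex sigma cU disjU.
exists g.
  apply: generatedS; exists 3, U, gamma; split=> //; exists sigma; last by split.
  by rewrite Alt_even odd_permM !odd_tperm.
have E i y : U y -> g (rho (gamma i) y) = rho (gamma (sigma i)) y.
  by move=> Uy; rewrite (gin i); [rewrite rhoME rhoK|exists y].
have s0 : sigma o0 = o1 by rewrite permM !permE.
have s1 : sigma o1 = o2 by rewrite permM !permE.
have s2 : sigma o2 = o0 by rewrite permM !permE.
split=> [y Uy|y Uy|y Uy|x nx].
- by rewrite (E o0 y Uy) s0.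
- by rewrite (E o1 y Uy) s1.
- by rewrite (E o2 y Uy) s2.
apply: gout => -[i _ [y Uy yx]]; have [xa xb xc] := nx y Uy.
case: i yx => -[|[|[|//]]] li; rewrite /gamma /= => /esym.
- exact: xa.
- exact: xb.
- exact: xc.
Qed.

Lemma tricycleP U a b c : clopen U -> disjoint3 U a b c ->
  is_tricycle U a b c (tricycle U a b c).
Proof.
move=> cU dU; have [g _ gP] := is_tricycle_ex cU dU.
rewrite /tricycle.
by case: (xgetP 1 [set g | [/\ clopen U, disjoint3 U a b c & is_tricycle U a b c g]])
  => [_ _ []|/(_ g)] //; case.
Qed.

Lemma tricycleE U a b c g : clopen U -> disjoint3 U a b c ->
  is_tricycle U a b c g -> tricycle U a b c = g.
Proof. by move=> cU dU; apply: is_tricycle_uniq; apply: tricycleP. Qed.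

Lemma tricycle_alt U a b c : A (tricycle U a b c).
Proof.
rewrite /tricycle.
case: (xgetP 1 [set g | [/\ clopen U, disjoint3 U a b c & is_tricycle U a b c g]]).
  move=> _ -> [cU dU gP]; have [g Ag /(is_tricycle_uniq gP) ->//] :=
    is_tricycle_ex cU dU.
by move=> _; apply: subgroup1 alt_subgroup.
Qed.

Lemma tricycle0 a b c : tricycle set0 a b c = 1.
Proof. by apply: tricycleE; [apply: clopen0|split|split]. Qed.

(** Conjugation only depends on the effect of [g] on the three legs; most
    identities between 3-cycles below are instances of this one. *)
Lemma tricycleJ g U a b c a' b' c' : clopen U ->
  disjoint3 U a b c -> disjoint3 U a' b' c' ->
  (forall y, U y -> [/\ g (rho a y) = rho a' y, g (rho b y) = rho b' y &
                        g (rho c y) = rho c' y]) ->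
  g * tricycle U a b c * g^-1 = tricycle U a' b' c'.
Proof.
move=> cU dU dU' gU; have [ta tb tc t1] := tricycleP cU dU.
have gV y : U y -> [/\ g^-1 (rho a' y) = rho a y, g^-1 (rho b' y) = rho b y &
                       g^-1 (rho c' y) = rho c y].
  by move=> /gU[ga gb gc]; rewrite -ga -gb -gc !homeoK.
apply/esym/tricycleE => //; split=> [y Uy|y Uy|y Uy|x nx]; rewrite !homeoME.
- by case: (gU y Uy) (gV y Uy) => _ gb _ [-> _ _]; rewrite ta.
- by case: (gU y Uy) (gV y Uy) => _ _ gc [_ -> _]; rewrite tb.
- by case: (gU y Uy) (gV y Uy) => ga _ _ [_ _ ->]; rewrite tc.
rewrite t1 ?homeoKV // => y Uy; have [xa xb xc] := nx y Uy.
have [ga gb gc] := gU y Uy.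
by split=> xy; [apply: xa; rewrite -ga|apply: xb; rewrite -gb|apply: xc; rewrite -gc];
  rewrite -xy homeoKV.
Qed.

Lemma disjoint3_rot U a b c : disjoint3 U a b c -> disjoint3 U b c a.
Proof. by move=> [ab ac bc]; split=> //; apply: disjoint_legsC. Qed.

Lemma disjoint3_swap U a b c : disjoint3 U a b c -> disjoint3 U a c b.
Proof. by move=> [ab ac bc]; split=> //; apply: disjoint_legsC. Qed.

Lemma tricycle_rot U a b c : clopen U -> disjoint3 U a b c ->
  tricycle U b c a = tricycle U a b c.
Proof.
move=> cU dU; apply: tricycleE => //; first exact: disjoint3_rot.
have [ta tb tc t1] := tricycleP cU dU; split=> // x nx.
by apply: t1 => y /nx[].
Qed.

Lemma tricycleV U a b c : clopen U -> disjoint3 U a b c ->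
  (tricycle U a b c)^-1 = tricycle U a c b.
Proof.
move=> cU dU; apply/esym/tricycleE => //; first exact: disjoint3_swap.
have [ta tb tc t1] := tricycleP cU dU.
split=> [y Uy|y Uy|y Uy|x nx]; apply: (@homeo_inj _ (tricycle U a b c)).
- by rewrite homeoKV tc.
- by rewrite homeoKV tb.
- by rewrite homeoKV ta.
by rewrite homeoKV t1 // => y /nx[].
Qed.

Lemma tricycleU U V a b c : clopen U -> clopen V -> U `&` V = set0 ->
  disjoint3 (U `|` V) a b c ->
  tricycle (U `|` V) a b c = tricycle U a b c * tricycle V a b c.
Proof.
move=> cU cV UV0 dUV; have nUV y : U y -> V y -> False.
  by move=> Uy Vy; have : (U `&` V) y by []; rewrite UV0.
apply: tricycleE => //; first exact: clopen_setU.
have [ta tb tc t1] := tricycleP cU (disjoint3S (@subsetUl _ U V) dUV).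
have [va vb vc v1] := tricycleP cV (disjoint3S (@subsetUr _ U V) dUV).
have [ab ac bc] := dUV.
have off (P Q : set X) x : P `<=` (U `|` V) -> Q `<=` (U `|` V) ->
    (forall y, P y -> Q y -> False) -> P x -> forall y, Q y ->
    [/\ [/\ rho a x <> rho a y, rho a x <> rho b y & rho a x <> rho c y],
        [/\ rho b x <> rho a y, rho b x <> rho b y & rho b x <> rho c y] &
        [/\ rho c x <> rho a y, rho c x <> rho b y & rho c x <> rho c y]].
  move=> PUV QUV PQ Px y Qy; have [Px' Qy'] := (PUV x Px, QUV y Qy).
  have neq : x <> y by move=> xy; apply: (PQ x); rewrite // xy.
  split; split=> //; do ?by move=> /rho_inj.
  - exact: ab.
  - exact: ac.
  - exact: disjoint_legsC ab _ _ Px' Qy'.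
  - exact: bc.
  - exact: disjoint_legsC ac _ _ Px' Qy'.
  - exact: disjoint_legsC bc _ _ Px' Qy'.
have offU := off U V _ (@subsetUl _ U V) (@subsetUr _ U V) nUV.
have offV := off V U _ (@subsetUr _ U V) (@subsetUl _ U V)
  (fun y Vy Uy => nUV y Uy Vy).
split=> [y|y|y|x nx]; rewrite homeoME.
- case=> [Uy|Vy].
    by rewrite v1 ?ta // => z /(offU y Uy)[].
  by rewrite va // t1 // => z /(offV y Vy)[].
- case=> [Uy|Vy].
    by rewrite v1 ?tb // => z /(offU y Uy)[].
  by rewrite vb // t1 // => z /(offV y Vy)[].
- case=> [Uy|Vy].
    by rewrite v1 ?tc // => z /(offU y Uy)[].
  by rewrite vc // t1 // => z /(offV y Vy)[].
rewrite v1 => [|y Vy]; last by apply: nx; right.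
by rewrite t1 // => y Uy; apply: nx; left.
Qed.

(** Only the legs, not the base, are intrinsic: the base point of a 3-cycle can
    be moved along the orbit. *)
Lemma tricycle_shift U s a b c :
  clopen U -> disjoint3 U (a * s) (b * s) (c * s) ->
  tricycle [set x | U (rho s^-1 x)] a b c = tricycle U (a * s) (b * s) (c * s).
Proof.
move=> cU dU.
have cU' : clopen [set x | U (rho s^-1 x)] by apply: clopen_preim.
apply: tricycleE => //.
  have [ab ac bc] := dU.
  by split=> y z Uy Uz; [have := ab _ _ Uy Uz|have := ac _ _ Uy Uz|
     have := bc _ _ Uy Uz]; rewrite !rhoME !rhoKV.
have [ta tb tc t1] := tricycleP cU dU.
split=> [y Uy|y Uy|y Uy|x nx].
- by have := ta _ Uy; rewrite !rhoME !rhoKV.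
- by have := tb _ Uy; rewrite !rhoME !rhoKV.
- by have := tc _ Uy; rewrite !rhoME !rhoKV.
apply: t1 => y Uy; rewrite !rhoME; apply: nx.
by rewrite /= rhoK.
Qed.

(** The permutation identity (a d e)(c e d) = (c a d). *)
Lemma tricycleM4 U a c d e : clopen U ->
  disjoint3 U a d e -> disjoint3 U c d e -> disjoint_legs U a c ->
  tricycle U a d e * tricycle U c e d = tricycle U c a d.
Proof.
move=> cU d1 d2 ac; have [ad ae de] := d1; have [cd ce _] := d2.
have ca := disjoint_legsC ac.
have dc := disjoint_legsC cd; have ec := disjoint_legsC ce.
have [ta td te t1] := tricycleP cU d1.
have [vc ve vd v1] := tricycleP cU (disjoint3_swap d2).
apply/esym/tricycleE => //; split=> [y Uy|y Uy|y Uy|x nx]; rewrite homeoME.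
- by rewrite vc // te.
- by rewrite v1 ?ta // => z Uz; split; [apply: ac|apply: ae|apply: ad].
- rewrite vd // t1 // => z Uz; split; [exact: ca|exact: cd|exact: ce].
have [[y [Uy ->]]|ne] := pselect (exists y, U y /\ x = rho e y).
  by rewrite ve // td.
rewrite v1 => [|y Uy]; last first.
  by have [xc xa xd] := nx y Uy; split=> // xe; apply: ne; exists y.
rewrite t1 // => y Uy.
by have [xc xa xd] := nx y Uy; split=> // xe; apply: ne; exists y.
Qed.

Definition separated U E : Prop := forall a b,
  a \in E -> b \in E -> a <> b -> disjoint_legs U a b.

Lemma separatedS U V E : V `<=` U -> separated U E -> separated V E.
Proof. by move=> VU sU a b aE bE ab; apply: disjoint_legsS (sU a b aE bE ab). Qed.

Lemma separated_disjoint3 U E a b c : separated U E ->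
  a \in E -> b \in E -> c \in E -> uniq [:: a; b; c] -> disjoint3 U a b c.
Proof.
move=> sU aE bE cE /=; rewrite !inE negb_or andbT.
by move=> /andP[/andP[/eqP ab /eqP ac] /eqP bc]; split; apply: sU.
Qed.

Lemma separated_near (X_cantor : is_cantor_space X) x E :
  uniq [seq rho a x | a <- E] ->
  exists2 N, clopen N /\ N x &
    forall V, clopen V -> V `<=` N -> separated V E.
Proof.
move=> uE.
have [|N Nx NE] := @local_clopen_all X _ [seq (a, b) | a <- E, b <- E]
    (fun p V => p.1 <> p.2 -> disjoint_legs V p.1 p.2) x.
  move=> [a b] /allpairsP[[a' b'] /= [aE bE [-> ->]]] {a b}.
  have [->|/eqP ab] := eqVneq a' b'.
    by exists setT; [split=> //; apply: clopenX|].
  have xab : rho a' x <> rho b' x.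
    move=> /eqP; rewrite -(nth_index 1 aE) -(nth_index 1 bE).
    rewrite -!(nth_map 1 x (fun a => rho a x)) ?index_mem //.
    rewrite nth_uniq ?size_map ?index_mem // => /eqP ii.
    by apply: ab; rewrite -(nth_index 1 aE) ii nth_index.
  have [U [cU Ua Ub]] := cantor_clopen_sep X_cantor xab.
  exists [set y | U (rho a' y) /\ ~ U (rho b' y)].
    split=> //; apply: clopen_setI; first exact: clopen_preim.
    by apply: clopen_setC; apply: (clopen_preim (rho b') cU).
  move=> V _ VN _ y z /VN[Uy _] /VN[_ nUz] yz; apply: nUz; by rewrite -yz.
exists N => // V cV VN a b aE bE; apply: (NE V cV VN (a, b)).
by apply/allpairsP; exists (a, b).
Qed.

Definition all_tricycles H U E : Prop := forall a b c,
  a \in E -> b \in E -> c \in E -> uniq [:: a; b; c] -> H (tricycle U a b c).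

Lemma fresh_leg (T : eqType) (E s : seq T) :
  uniq E -> (size s < size E)%N -> exists2 e, e \in E & e \notin s.
Proof.
move=> uE sE; have [/allP all_s|/allPn[e]] := boolP (all (mem s) E).
  by have := uniq_leq_size uE all_s; rewrite leqNgt sE.
by exists e.
Qed.

(** Replacing one leg at a time by conjugation. The leg [c] is moved to [d] by a
    3-cycle [c -> d -> e] avoiding [a] and [b], whence at least five legs. *)
Lemma all_tricycles_spread H N U E a b c : subgroup H -> clopen N -> clopen U ->
  U `<=` N -> separated N E -> uniq E -> (5 <= size E)%N ->
  all_tricycles H N E ->
  a \in E -> b \in E -> c \in E -> uniq [:: a; b; c] -> H (tricycle U a b c) ->
  all_tricycles H U E.
Proof.
move=> sH cN cU UN sN uE E5 HN.
have sU := separatedS UN sN.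
pose P a b c := [/\ a \in E, b \in E, c \in E, uniq [:: a; b; c] &
                    H (tricycle U a b c)].
have Prot a' b' c' : P a' b' c' -> P b' c' a'.
  move=> [aE bE cE u h]; split=> //; first by rewrite -(rot_uniq 2) /rot /=.
  by rewrite tricycle_rot //; apply: separated_disjoint3 sU _ _ _ _.
have Pswap a' b' c' : P a' b' c' -> P a' c' b'.
  move=> [aE bE cE u h]; split=> //.
    by move: u; rewrite /= !inE !negb_or (eq_sym b') => /and3P[/andP[-> ->] ->].
  rewrite -tricycleV //; first exact: subgroupV.
  exact: separated_disjoint3 sU _ _ _ _.
have Pmove a' b' c' d : P a' b' c' -> d \in E -> d \notin [:: a'; b'] -> P a' b' d.
  move=> Pabc dE dab; have [->//|dc] := eqVneq d c'.
  have [aE bE cE u h] := Pabc.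
  have [//|e eE] := @fresh_leg _ E [:: a'; b'; c'; d] uE _.
  rewrite !inE !negb_or => /and4P[ea eb ec ed].
  move: (u) dab; rewrite /= !inE !negb_or !andbT.
  move=> /andP[/andP[ab ac] bc] /andP[da db].
  have u' : uniq [:: a'; b'; d].
    by rewrite /= !inE !negb_or ab (eq_sym a' d) da (eq_sym b' d) db.
  have u2 : uniq [:: c'; d; e].
    by rewrite /= !inE !negb_or (eq_sym c' d) dc (eq_sym c' e) ec (eq_sym d e) ed.
  split=> //.
  have d2 := separated_disjoint3 sN cE dE eE u2.
  have [tc _ _ t1] := tricycleP cN d2.
  rewrite -(@tricycleJ (tricycle N c' d e) U a' b' c' a' b' d) //.
  - have hN : H (tricycle N c' d e) by apply: HN.
    by apply: subgroupM => //; [apply: subgroupM|apply: subgroupV].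
  - exact: separated_disjoint3 sU _ _ _ _.
  - exact: separated_disjoint3 sU _ _ _ _.
  move=> y /UN Ny; split; last exact: tc.
    by apply: t1 => z Nz; split; apply: sN => //; apply/eqP; rewrite // eq_sym.
  by apply: t1 => z Nz; split; apply: sN => //; apply/eqP; rewrite // eq_sym.
move=> aE bE cE u h a' b' c' aE' bE' cE' u'.
have P0 : P a b c by [].
have [x [y Pa]] : exists x y : Lambda, P a' x y.
  have [->|aa] := eqVneq a' a; first by exists b, c.
  have [->|ab] := eqVneq a' b; first by exists c, a; exact: Prot.
  exists a, b; apply/Prot/Prot; apply: Pmove P0 _ _ => //.
  by rewrite !inE negb_or aa ab.
move: u'; rewrite /= !inE negb_or andbT => /andP[/andP[ab' ac'] bc'].
have [z Pb] : exists z : Lambda, P a' b' z.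
  have [->|bx] := eqVneq b' x; first by exists y.
  have [->|by'] := eqVneq b' y; first by exists x; apply: Pswap.
  exists x; apply: Pswap; apply: Pmove Pa _ _ => //.
  by rewrite !inE negb_or bx eq_sym ab'.
suff [] : P a' b' c' by [].
apply: Pmove Pb _ _ => //.
by rewrite !inE negb_or !(eq_sym c') ac' bc'.
Qed.

(** The commutator of two 3-cycles that share exactly one leg is supported over
    the intersection of their bases. *)
Lemma all_tricyclesI H N U V E : subgroup H -> clopen N -> clopen U -> clopen V ->
  U `<=` N -> V `<=` N -> separated N E -> uniq E -> (5 <= size E)%N ->
  all_tricycles H N E -> all_tricycles H U E -> all_tricycles H V E ->
  all_tricycles H (U `&` V) E.
Proof.
move=> sH cN cU cV UN VN sN uE E5 HN HU HV.
have [a [b [c [d [e [aE bE cE dE eE]]]]]] : exists a b c d e,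
    [/\ a \in E, b \in E, c \in E, d \in E & e \in E /\ uniq [:: a; b; c; d; e]].
  move: uE E5; case: E {sN HN HU HV} => [|a [|b [|c [|d [|e E]]]]] // + _.
  rewrite -[_ :: _]/([:: a; b; c; d; e] ++ E) cat_uniq => /andP[u _].
  by exists a, b, c, d, e; rewrite !inE !eqxx !orbT.
case: eE => eE; rewrite /= !inE !negb_or !andbT.
move=> /andP[/and4P[ab ac ad ae] /andP[/and3P[bc bd be] /andP[/andP[cd ce] de]]].
have cUV : clopen (U `&` V) by apply: clopen_setI.
have cVU : clopen (V `\` U) by apply: clopen_setD.
have sep W : W `<=` N -> forall x y z : Lambda, x \in E -> y \in E -> z \in E ->
    x != y -> x != z -> y != z -> disjoint3 W x y z.
  move=> WN x y z xE yE zE xy xz yz; apply: separated_disjoint3 (separatedS WN sN) _ _ _ _ => //.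
  by rewrite /= !inE negb_or xy xz yz.
have UVN : U `&` V `<=` N by move=> x [/UN].
have VUN : V `\` U `<=` N by move=> x [/VN].
have tri3 (x y z : Lambda) : x != y -> x != z -> y != z -> uniq [:: x; y; z].
  by move=> xy xz yz; rewrite /= !inE negb_or xy xz yz.
have ca : c != a by rewrite eq_sym.
apply: (@all_tricycles_spread H N (U `&` V) E c a d) => //; first exact: tri3.
pose al := tricycle U a b c.
have dU := sep U UN a b c aE bE cE ab ac bc.
have [ta tb tc t1] := tricycleP cU dU.
have VE : V = (U `&` V) `|` (V `\` U) by rewrite setIC setUIDK.
have beE : tricycle V c d e =
    tricycle (U `&` V) c d e * tricycle (V `\` U) c d e.
  rewrite {1}VE tricycleU //; last by rewrite -VE; apply: sep.
  by rewrite -subset0 => x [[Ux _] [_]].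
have fixU x y (z : Lambda) : z \in E -> z != a -> z != b -> z != c -> N y ->
    x = rho z y -> tricycle U a b c x = x.
  move=> zE za zb zc Ny ->; apply: t1 => w /UN Nw.
  by split; apply: sN => //; apply/eqP.
have J1 : al * tricycle (U `&` V) c d e * al^-1 = tricycle (U `&` V) a d e.
  apply: tricycleJ => //; do ?exact: sep.
  move=> y [Uy /VN Ny]; split; first exact: tc.
    by apply: (fixU _ y d) => //; rewrite eq_sym.
  by apply: (fixU _ y e) => //; rewrite eq_sym.
have J2 : al * tricycle (V `\` U) c d e * al^-1 = tricycle (V `\` U) c d e.
  apply: tricycleJ => //; do ?exact: sep.
  move=> y [/VN Ny nUy]; split.
  - apply: t1 => w Uw; have Nw := UN w Uw.
    split; [by apply: sN => //; apply/eqP|by apply: sN => //; apply/eqP; rewrite eq_sym|].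
    by move=> /rho_inj yw; apply: nUy; rewrite yw.
  - by apply: (fixU _ y d) => //; rewrite eq_sym.
  - by apply: (fixU _ y e) => //; rewrite eq_sym.
rewrite -(tricycleM4 cUV (sep _ UVN a d e aE dE eE ad ae de)
  (sep _ UVN c d e cE dE eE cd ce de)); last by apply: separatedS UVN sN _ _ _ _ _ => //; apply/eqP.
rewrite -(@tricycleV _ c d e cUV); last exact: sep.
rewrite -J1.
have -> : (tricycle (U `&` V) c d e)^-1 =
    al * tricycle (V `\` U) c d e * al^-1 * (tricycle V c d e)^-1.
  by rewrite J2 beE invgM mulVKg.
rewrite (_ : _ * _ = al * tricycle V c d e * al^-1 * (tricycle V c d e)^-1); last first.
  by rewrite !mulgA mulgKV -(mulgA al) -beE.
have hU : H al by apply: HU => //; apply: tri3.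
have hV : H (tricycle V c d e) by apply: HV => //; apply: tri3.
have hV1 := subgroupV sH hV; have hU1 := subgroupV sH hU.
by do !apply: subgroupM => //.
Qed.

End ThreeCycles.

(** * Generation of the alternating full group by small 3-cycles *)

(** An even permutation is reduced to [1] by removing 3-cycles: removing
    [i -> s i -> k -> i] makes [i] a fixed point, and another moved point [k]
    exists because a transposition is odd. *)
Lemma even_perm_ind (T : finType) (Q : {perm T} -> Prop) :
  Q 1 ->
  (forall (s : {perm T}) i j k, uniq [:: i; j; k] -> Q s ->
    Q (s * (tperm i j * tperm i k))) ->
  forall s : {perm T}, ~~ odd_perm s -> Q s.
Proof.
move=> Q1 QM s; have [m] := ubnP #|[pred i | s i != i]|.
elim: m s => // m IHm s sm even_s.
have [/forallP s1|/forallPn[i si]] := boolP [forall i, s i == i].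
  by rewrite (_ : s = 1) //; apply/permP => i; rewrite perm1; apply/eqP.
pose j := s i; have sj : s j != j by rewrite /j (inj_eq perm_inj).
have [k [ki kj sk]] : exists k, [/\ k != i, k != j & s k != k].
  apply: contrapT => nk; have {}nk k : k != i -> k != j -> s k = k.
    by move=> ki kj; apply: contrapT => /eqP sk; apply: nk; exists k.
  have sji : s j = i.
    apply: contrapT => /eqP ji; have := nk (s j) ji sj.
    by move/perm_inj => /eqP; rewrite (negPf sj).
  suff s_tperm : s = tperm i j.
    by move: even_s; rewrite s_tperm odd_tperm /j eq_sym si.
  apply/permP => x; case: tpermP => [->|->|/eqP xi /eqP xj] //; exact: nk.
pose t := tperm i j * tperm i k.
have ti : t i = j by rewrite permM tpermL tpermD // eq_sym // si.
have tfix x : x != i -> x != j -> x != k -> t x = x.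
  by move=> xi xj xk; rewrite permM !tpermD // eq_sym.
have -> : s = (s * t^-1) * t by rewrite mulgKV.
have u : uniq [:: i; j; k].
  by rewrite /= !inE negb_or eq_sym si eq_sym ki eq_sym kj.
apply: QM => //; apply: IHm; last first.
  by rewrite odd_permM odd_permV odd_permM !odd_tperm [i == j]eq_sym si
    [i == k]eq_sym ki addbF.
rewrite ltnS in sm; apply: leq_trans sm; apply: proper_card.
apply/properP; split; last first.
  by exists i; rewrite !inE ?si // permM -/j -{1}ti permK eqxx.
apply/fintype.subsetP => x; rewrite !inE; apply: contra => /eqP sx.
rewrite permM sx -{1}(tfix x) ?permK //.
- by apply/eqP => xi; move: si; rewrite -xi sx eqxx.
- by apply/eqP => xj; move: sj; rewrite -xj sx eqxx.
- by apply/eqP => xk; move: sk; rewrite -xk sx eqxx.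
Qed.

Section Generation.
Variables (Lambda : groupType) (X : topologicalType).
Variable rho : {multiplicative Lambda -> homeo X}.
Hypothesis X_cantor : is_cantor_space X.
Implicit Types (U V W N : set X) (x y z : X) (a b c d e s : Lambda).
Implicit Types (g h : homeo X) (H : set (homeo X)).

Local Notation A := (alternating_full_group rho).

Section PermSpec.
Variables (n : nat) (gamma : 'I_n -> Lambda).

(** [is_perm_homeo] with tiles described by the points [y] of the base. *)
Let perm_spec V (sigma : 'S_n) g : Prop :=
  (forall i y, V y -> g (rho (gamma i) y) = rho (gamma (sigma i)) y) /\
  (forall x, (forall i y, V y -> x <> rho (gamma i) y) -> g x = x).

Let disj V : Prop :=
  forall i j y z, V y -> V z -> rho (gamma i) y = rho (gamma j) z -> i = j.

Let perm_specP V sigma g :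
  is_perm_homeo rho V gamma sigma g -> perm_spec V sigma g.
Proof.
move=> [gin gout]; split=> [i y Vy|x nx].
  by rewrite (gin i); [rewrite rhoME rhoK|exists y].
by apply: gout => -[i _ [y Vy /esym]]; apply: nx.
Qed.

Lemma perm_homeo_in_subgroup H U sigma g :
  subgroup H ->
  (forall x a b c, uniq [:: rho a x; rho b x; rho c x] ->
    exists2 N, clopen N /\ N x &
      forall V, clopen V -> V `<=` N -> H (tricycle rho V a b c)) ->
  clopen U -> translates_disjoint rho U gamma -> sigma \in 'Alt_('I_n) ->
  is_perm_homeo rho U gamma sigma g -> H g.
Proof.
move=> sH small cU tU; rewrite Alt_even => even_s /perm_specP gP.
have dU : disj U.
  move=> i j y z Uy Uz yz; apply: tU => //.
  by exists (rho (gamma i) y); split; [exists y|rewrite yz; exists z].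
pose P V := forall sigma' g', ~~ odd_perm sigma' ->
  perm_spec (V `&` U) sigma' g' -> H g'.
suff PT : P setT by apply: PT even_s _; rewrite setTI.
apply: (cantor_clopen_ind X_cantor); last exact: clopenX.
- move=> s h _ [_ h1]; rewrite (_ : h = 1); first exact: subgroup1.
  by apply: homeo_eq => x; apply: h1 => i y; rewrite set0I.
- move=> V W cV cW VW0 PV PW s h even_h [hin hout].
  have dVU : translates_disjoint rho (V `&` U) gamma.
    move=> i j _ _ [x [[y [_ Uy] <-] [z [_ Uz] zy]]].
    by apply: dU Uy Uz _; rewrite zy.
  have [g1 [/perm_specP g1P _]] :=
    is_perm_homeo_ex s (clopen_setI cV cU) dVU.
  have Hg1 : H g1 by apply: PV even_h g1P.
  have [gin gout] := g1P.
  have nVW y : V y -> W y -> False.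
    by move=> Vy Wy; have : (V `&` W) y by []; rewrite VW0.
  suff Hg : H (g1^-1 * h) by rewrite -(mulVKg g1 h); apply: subgroupM.
  apply: PW even_h _; split=> [i y [Wy Uy]|x nx]; rewrite homeoME.
    rewrite hin; last by split; [right|].
    apply: homeo_inv_fix; apply: gout => j z [Vz Uz] yz.
    have ij := dU _ _ _ _ Uy Uz yz; move: yz; rewrite ij => /rho_inj yz.
    by apply: (nVW y); rewrite // yz.
  have [[i [y [Vy Uy ->]]]|nV] :=
      pselect (exists i y, [/\ V y, U y & x = rho (gamma i) y]).
    by rewrite hin ?(gin i) -?(gin i) ?homeoK //; split=> //; left.
  rewrite hout => [|i y [[Vy|Wy] Uy] xy].
  + apply: homeo_inv_fix; apply: gout => i y [Vy Uy] xy.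
    by apply: nV; exists i, y.
  + by apply: nV; exists i, y.
  + exact: nx xy.
move=> x; have [Ux|nUx] := pselect (U x); last first.
  exists (~` U); first by split=> //; apply: clopen_setC.
  move=> V _ VU s h _ [_ h1]; rewrite (_ : h = 1); first exact: subgroup1.
  by apply: homeo_eq => y; apply: h1 => i z [/VU].
have [|N [cN Nx] HN] := @local_clopen_all X _ (enum [set: 'I_n * 'I_n * 'I_n])
    (fun t V => uniq [:: t.1.1; t.1.2; t.2] ->
      H (tricycle rho V (gamma t.1.1) (gamma t.1.2) (gamma t.2))) x.
  move=> [[i j] k] _ /=; have [u|nu] := boolP (uniq [:: i; j; k]); last first.
    exists setT; first by split=> //; apply: clopenX.
    by move=> V _ _ u; move: nu; rewrite /= u.
  have [|N Nx HN] := small x (gamma i) (gamma j) (gamma k).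
    move: u; rewrite /= !inE !negb_or !andbT => /andP[/andP[ij ik] jk].
    rewrite -andbA; apply/and3P.
    by split; [apply: contra ij|apply: contra ik|apply: contra jk] =>
      /eqP /(dU _ _ _ _ Ux Ux) ->.
  by exists N => // V cV VN _; apply: HN.
exists (N `&` U); first by split; [apply: clopen_setI|].
move=> V cV VNU; rewrite /P.
have -> : V `&` U = V by apply/seteqP; split=> [y []|y Vy] //; split=> //; case: (VNU y Vy).
have VU : V `<=` U by move=> y /VNU[].
have VN : V `<=` N by move=> y /VNU[].
suff Q (s : 'S_n) : ~~ odd_perm s -> forall h, perm_spec V s h -> H h.
  by move=> s h /Q; apply.
apply: (even_perm_ind (Q := fun s : 'S_n => forall h, perm_spec V s h -> H h)).
  move=> h [hin hout]; rewrite (_ : h = 1); first exact: subgroup1.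
  apply: homeo_eq => y; have [[i [z [Vz ->]]]|ny] :=
    pselect (exists i z, V z /\ y = rho (gamma i) z).
    by rewrite hin // perm1.
  by apply: hout => i z Vz yz; apply: ny; exists i, z.
move=> {}s i j k u IHs h [hin hout].
have d3 : disjoint3 rho V (gamma i) (gamma j) (gamma k).
  move: u; rewrite /= !inE !negb_or !andbT => /andP[/andP[ij ik] jk].
  by split=> y z /VU Uy /VU Uz /(dU _ _ _ _ Uy Uz) E;
    [move: ij|move: ik|move: jk]; rewrite E eqxx.
pose t := tricycle rho V (gamma i) (gamma j) (gamma k).
have Ht : H t.
  by apply: (HN V cV VN (i, j, k)) u; rewrite mem_enum inE.
have [ti tj tk t1] : is_tricycle rho V (gamma i) (gamma j) (gamma k) t.
  exact: tricycleP.
pose tau := (tperm i j * tperm i k)%g.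
move: (u); rewrite /= !inE !negb_or !andbT => /andP[/andP[ij ik] jk].
have [ji ki kj] : [/\ j != i, k != i & k != j] by split; rewrite eq_sym.
have tE l y : V y -> t (rho (gamma l) y) = rho (gamma (tau l)) y.
  move=> Vy; rewrite /tau permM.
  have [->|li] := eqVneq l i; first by rewrite tpermL (tpermD ij kj) ti.
  have [->|lj] := eqVneq l j; first by rewrite tpermR tpermL tj.
  have [->|lk] := eqVneq l k; first by rewrite (tpermD ik jk) tpermR tk.
  have [il jl kl] : [/\ i != l, j != l & k != l] by split; rewrite eq_sym.
  rewrite (tpermD il jl) (tpermD il kl) t1 // => z Vz.
  split=> /(dU _ _ _ _ (VU _ Vy) (VU _ Vz)) E.
  - by rewrite E eqxx in li.
  - by rewrite E eqxx in lj.
  - by rewrite E eqxx in lk.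
suff Hg : H (t^-1 * h) by rewrite -(mulVKg t h); apply: subgroupM.
apply: IHs; split=> [l y Vy|y ny]; rewrite homeoME.
  by rewrite hin // permM -/tau -tE // homeoK.
rewrite hout //; apply: homeo_inv_fix; apply: t1 => z Vz.
by split; apply: ny.
Qed.

End PermSpec.

(** The base of an element permuting translates can be cut into small pieces by
    compactness, and over each piece the permutation is a product of 3-cycles. *)
Lemma alt_sub_of_small H : subgroup H ->
  (forall x a b c, uniq [:: rho a x; rho b x; rho c x] ->
    exists2 N, clopen N /\ N x &
      forall V, clopen V -> V `<=` N -> H (tricycle rho V a b c)) ->
  A `<=` H.
Proof.
move=> sH small; apply: generated_sub => // g [n [U [gamma [_ cU tU]]]].
move=> [sigma s_alt gP]; exact: perm_homeo_in_subgroup small cU tU s_alt gP.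
Qed.

End Generation.

(** * Transitivity, trivial centraliser, normality and simplicity *)

Section Support.
Variable X : topologicalType.
Implicit Types (U V : set X) (g h : homeo X) (x : X).

Definition supported U g : Prop := forall x, ~ U x -> g x = x.

Lemma supported_stable U g x : supported U g -> U x -> U (g x).
Proof.
move=> sg Ux; apply: contrapT => nU.
by move: (nU); have /homeo_inj -> := sg _ nU.
Qed.

Lemma supportedS U V g : U `<=` V -> supported U g -> supported V g.
Proof. by move=> UV sg x nV; apply: sg => /UV. Qed.

Lemma supportedV U g : supported U g -> supported U g^-1.
Proof. by move=> sg x nU; apply/homeo_inv_fix/sg. Qed.

Lemma supportedM U g h : supported U g -> supported U h -> supported U (g * h).
Proof. by move=> sg sh x nU; rewrite homeoME sh // sg. Qed.

Lemma supportedJ U g h : supported U g ->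
  supported [set x | U (h^-1 x)] (h * g * h^-1).
Proof. by move=> sg x nU; rewrite !homeoME sg // homeoKV. Qed.

Lemma supported_commute U V g h : U `&` V = set0 ->
  supported U g -> supported V h -> g * h = h * g.
Proof.
move=> UV0 sg sh; apply: homeo_eq => x; rewrite !homeoME.
have nUV y : U y -> ~ V y by move=> Uy Vy; have : (U `&` V) y by []; rewrite UV0.
have [Ux|nUx] := pselect (U x).
  by rewrite (sh x) ?(sh (g x)) //; apply: nUV => //; apply: supported_stable.
rewrite [g x]sg //; have [Vx|nVx] := pselect (V x).
  by rewrite sg // => Uhx; apply: nUV Uhx _; apply: supported_stable.
by rewrite sh // sg.
Qed.

(** If [h] moves [U] off itself then, for [a] and [b] supported in [U], the
    double commutator [[h, a], b] does not see [h] any more, because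
    [h a h^-1] is supported off [U] and commutes with what is supported in [U]. *)
Lemma double_commutator U h a b : (forall x, U x -> ~ U (h x)) ->
  supported U a -> supported U b ->
  let k := h * a * h^-1 * a^-1 in k * b * k^-1 * b^-1 = a^-1 * b * a * b^-1.
Proof.
move=> hU sa sb k; set c := h * a * h^-1.
have cE : k = c * a^-1 by [].
have sc : supported [set x | U (h^-1 x)] c by apply: supportedJ.
have s2 : supported U (a^-1 * b * a).
  by do 2?apply: supportedM => //; apply: supportedV.
rewrite cE invgM invgK (_ : _ * _ * _ * _ = c * (a^-1 * b * a) * c^-1 * b^-1).
  rewrite (supported_commute _ sc s2) ?mulgK //.
  by rewrite -subset0 => x [/= /hU]; rewrite homeoKV.
by rewrite !mulgA.
Qed.

End Support.

Section Dynamics.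
Variables (Lambda : groupType) (X : topologicalType).
Variable rho : {multiplicative Lambda -> homeo X}.
Hypothesis X_cantor : is_cantor_space X.
Hypothesis rho_minimal : minimal_action rho.
Implicit Types (U V W N : set X) (x y z : X) (a b c d e s : Lambda).
Implicit Types (g h : homeo X) (H : set (homeo X)).

Local Notation A := (alternating_full_group rho).

Lemma clopen_avoiding U x (s : seq X) : open U -> U x -> exists W,
  [/\ clopen W, W !=set0, W `<=` U & forall z, z \in s -> ~ W z].
Proof.
move=> oU Ux; have [y Uy ys] := cantor_open_infinite X_cantor s oU Ux.
have [|N [cN Ny] Ns] := @local_clopen_all X _ s (fun z V => ~ V z) y.
  move=> z zs; have [yz|W [cW Wy Wz]] := @cantor_clopen_sep _ X_cantor y z.
    by move: ys; rewrite yz zs.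
  by exists W => // V _ VW /VW.
have [|W [cW Wy] WU] := @cantor_clopen_basis _ X_cantor y U.
  exact: open_nbhs_nbhs.
have cNW := clopen_setI cN cW.
exists (N `&` W); split=> //; [by exists y|by move=> z [_ /WU]|].
by apply: Ns => // z [].
Qed.

Lemma orbit_avoiding U x y (s : seq X) : open U -> U x ->
  exists2 a, U (rho a y) & rho a y \notin s.
Proof.
move=> oU Ux; have [W [[oW _] W0 WU Ws]] := clopen_avoiding s oU Ux.
have [w [Ww [a _ aw]]] := rho_minimal y W0 oW.
by exists a; rewrite aw; [apply: WU|apply/negP => /Ws].
Qed.

(** A 3-cycle on [z], a point of its orbit in [W] and a third point of its orbit
    in [V]. *)
Lemma alt_move V z W : clopen V -> V z -> open W -> W !=set0 -> W `<=` V ->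
  exists g, [/\ A g, supported V g & W (g z)].
Proof.
move=> cV Vz oW [w Ww] WV.
have [Wz|nWz] := pselect (W z).
  exists 1; split=> //; exact: subgroup1 (alt_subgroup rho).
have [a Wa az] := orbit_avoiding z [:: z] oW Ww.
have [b Vb bz] := orbit_avoiding z [:: z; rho a z] cV.1 Vz.
have u : uniq [seq rho i z | i <- [:: 1; a; b]].
  move: az bz; rewrite /= !inE !negb_or rho1E => az /andP[bz ba].
  by rewrite andbT eq_sym az eq_sym bz eq_sym ba.
have [N [cN Nz] sN] := separated_near X_cantor u.
pose U := N `&` (V `&` ([set y | V (rho a y)] `&` [set y | V (rho b y)])).
have cU : clopen U.
  by do !apply: clopen_setI => //; apply: clopen_preim.
have dU : disjoint3 rho U 1 a b.
  have sU := sN U cU (@subIsetl _ _ _).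
  by apply: separated_disjoint3 sU _ _ _ (map_uniq u); rewrite !inE eqxx ?orbT.
have [t1 ta tb tout] := tricycleP cU dU.
exists (tricycle rho U 1 a b); split; first exact: tricycle_alt.
  move=> x nVx; apply: tout => y [_ [Vy [Va' Vb']]].
  by split=> xy; apply: nVx; rewrite xy // rho1E.
have Uz : U z by split=> //; split=> //; split=> //; apply: WV.
by have := t1 z Uz; rewrite rho1E => ->.
Qed.

Lemma alt_move_avoiding x (zs : seq X) W : x \notin zs -> open W -> W !=set0 ->
  exists g, [/\ A g, W (g x) & forall z, z \in zs -> g z = z].
Proof.
move=> xzs oW [w Ww].
have [W' [cW' W0 W'W W's]] := clopen_avoiding zs oW Ww.
have [|N [cN Nx] Ns] := @local_clopen_all X _ zs (fun z V => ~ V z) x.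
  move=> z zin; have [xz|U [cU Ux Uz]] := @cantor_clopen_sep _ X_cantor x z.
    by move: xzs; rewrite xz zin.
  by exists U => // V _ VU /VU.
have [|||||g [Ag sg Wg]] := @alt_move (N `|` W') x W'.
- exact: clopen_setU.
- by left.
- exact: cW'.1.
- exact: W0.
- by move=> y; right.
exists g; split=> //; first exact: W'W.
by move=> z zin; apply: sg => -[|]; [apply: Ns|apply: W's].
Qed.

Lemma alt_gather (zs : seq X) U : uniq zs -> open U -> U !=set0 ->
  exists2 g, A g & forall z, z \in zs -> U (g z).
Proof.
move=> + oU U0; elim: zs => [_|z zs IHzs /= /andP[zzs /IHzs[g Ag gU]]].
  by exists 1 => //; apply: subgroup1 (alt_subgroup rho).
have [|||h [Ah hz hfix]] := @alt_move_avoiding (g z) [seq g y | y <- zs] U => //.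
  by rewrite mem_map //; apply: homeo_inj.
exists (h * g); first exact: subgroupM (alt_subgroup rho) Ah Ag.
move=> y; rewrite homeoME inE => /predU1P[->//|yzs].
by rewrite hfix ?map_f //; apply: gU.
Qed.

Lemma alt_2transitive x y V W : x <> y -> open V -> V !=set0 ->
  open W -> W !=set0 -> exists g, [/\ A g, V (g x) & W (g y)].
Proof.
move=> xy oV V0 oW W0.
have [|||g [Ag Vg _]] := @alt_move_avoiding x [::] V => //.
have [|||h [Ah Wh hfix]] := @alt_move_avoiding (g y) [:: g x] W => //.
  by rewrite inE; apply/eqP => /homeo_inj /esym.
exists (h * g); split=> //; first exact: subgroupM (alt_subgroup rho) Ah Ag.
by rewrite homeoME hfix ?mem_head.
Qed.

(** If [h] moves [x], an element that moves [x] and is supported near [x], away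
    from [h x], does not commute with [h]. *)
Lemma alt_centralizer h : (forall k : homeo X, A k -> h * k = k * h) -> h = 1.
Proof.
move=> hA; apply: contrapT => /homeo_neq1[x hx].
have [V [cV Vx Vhx]] : exists V, [/\ clopen V, V x & ~ V (h x)].
  by apply: cantor_clopen_sep => // /esym.
have [y Vy] := cantor_open_infinite X_cantor [:: x] cV.1 Vx.
rewrite inE => /eqP yx.
have [U [cU Uy Ux]] := cantor_clopen_sep X_cantor yx.
have [|||||g [Ag sg []]] := @alt_move V x (V `&` U) => //.
- exact: openI cV.1 cU.1.
- by exists y.
move=> _ Ugx; have /(congr1 (fun k : homeo X => k x)) := hA g Ag.
rewrite !homeoME (sg (h x)) // => /homeo_inj gx.
by apply: Ux; move: Ugx; rewrite gx.
Qed.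

(** Over a small base, [g] acts on each leg as a single element of [Lambda], so it
    conjugates a small 3-cycle to a 3-cycle. *)
Lemma alt_normal_full g h : full_group rho g -> A h -> A (g * h * g^-1).
Proof.
move=> fg Ah; rewrite -{1}[g]invgK.
suff : A `<=` [set k | A (g^-1^-1 * k * g^-1)] by apply.
apply: alt_sub_of_small => //; first exact/subgroup_conj/alt_subgroup.
move=> x b c d ubcd.
have loc e : exists e', exists2 N, clopen N /\ N x &
    forall y, N y -> g (rho e y) = rho (e' * e) y.
  have [U nU [e' gE]] := fg (rho e x).
  have [W [cW Wx] WU] := cantor_clopen_basis X_cantor nU.
  exists e', [set y | W (rho e y)]; first by split=> //; apply: clopen_preim.
  by move=> y /WU /gE; rewrite rhoME.
have [[b' [Nb [cNb Nbx] gb]] [c' [Nc [cNc Ncx] gc]] [d' [Nd [cNd Ndx] gd]]] :=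
  And3 (loc b) (loc c) (loc d).
have [M [cM Mx] sM] := @separated_near _ _ rho X_cantor x [:: b; c; d] ubcd.
exists (M `&` (Nb `&` (Nc `&` Nd))).
  by split; [do !apply: clopen_setI|].
move=> V cV VN; rewrite /= invgK.
have dV : disjoint3 rho V b c d.
  have sV := sM V cV (fun y Vy => (VN y Vy).1).
  have u := @map_uniq _ _ (fun i => rho i x) [:: b; c; d] ubcd.
  by apply: separated_disjoint3 sV _ _ _ u; rewrite !inE eqxx ?orbT.
have gV y : V y -> [/\ g (rho b y) = rho (b' * b) y,
    g (rho c y) = rho (c' * c) y & g (rho d y) = rho (d' * d) y].
  by move=> /VN[_ [/gb ? [/gc ? /gd ?]]].
have dV' : disjoint3 rho V (b' * b) (c' * c) (d' * d).
  case: dV => [dbc dbd dcd]; split=> y z /[dup] Vy /gV[gby gcy gdy]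
    /[dup] Vz /gV[gbz gcz gdz].
  - by rewrite -gby -gcz => /homeo_inj; apply: dbc.
  - by rewrite -gby -gdz => /homeo_inj; apply: dbd.
  - by rewrite -gcy -gdz => /homeo_inj; apply: dcd.
by rewrite (tricycleJ cV dV dV' gV); apply: tricycle_alt.
Qed.

(** By the double commutator trick, normal subgroups contain the commutators of
    elements supported in some clopen set, and a small 3-cycle is a commutator
    of two 3-cycles that can be conjugated into a given clopen set. *)
Lemma alt_simple H h : subgroup H ->
  (forall g k : homeo X, A g -> H k -> H (g * k * g^-1)) -> H h -> h <> 1 -> A `<=` H.
Proof.
move=> sH nH Hh /homeo_neq1[z hz].
have [U0 [cU0 U0z U0hz]] := cantor_clopen_sep X_cantor (nesym hz).
pose U := U0 `&` ~` [set y | U0 (h y)].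
have cU : clopen U.
  by apply: clopen_setI => //; apply/clopen_setC/clopen_preim.
have hU y : U y -> ~ U (h y) by move=> [_ nU] [].
apply: alt_sub_of_small => // x a b c uabc.
have [d _ dx] := @orbit_avoiding setT x x [:: rho a x; rho b x; rho c x] openT I.
have [e _ ex] := @orbit_avoiding setT x x
  [:: rho a x; rho b x; rho c x; rho d x] openT I.
pose E := [:: a; b; c; d; e].
have uE : uniq [seq rho l x | l <- E].
  rewrite (_ : map _ _ = rcons (rcons [:: rho a x; rho b x; rho c x] (rho d x)) (rho e x)) //.
  by rewrite !rcons_uniq; apply/and3P.
have uniqE : uniq E by apply: map_uniq uE.
have [|g Ag gU] := alt_gather uE cU.1; first by exists z.
have [N1 [cN1 N1x] sN1] := separated_near X_cantor uE.
have [|N2 [cN2 N2x] N2U] := @local_clopen_all X _ E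
    (fun l V => forall y, V y -> U (g (rho l y))) x.
  move=> l lE; exists [set y | U (g (rho l y))].
    split; last by apply: gU; apply: (map_f (fun l => rho l x)).
    by apply: (clopen_preim (g * rho l)).
  by move=> V _ VU y /VU.
exists (N1 `&` N2); first by split=> //; apply: clopen_setI.
move=> V cV VN; have sV := sN1 V cV (fun y Vy => (VN y Vy).1).
have {N2U} VU := N2U V cV (fun y Vy => (VN y Vy).2).
have [aE bE cE dE eE] : [/\ a \in E, b \in E, c \in E, d \in E & e \in E].
  by rewrite !inE !eqxx !orbT.
have dis i j k : i \in E -> j \in E -> k \in E -> uniq [:: i; j; k] ->
    disjoint3 rho V i j k by apply: separated_disjoint3.
move: (uniqE); rewrite /= !inE !negb_or !andbT.
move=> /andP[/and4P[ab ac ad ae] /andP[/and3P[bc bd be] /andP[/andP[cd ce] de]]].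
pose al := tricycle rho V b d a; pose be' := tricycle rho V a c e.
have dal : disjoint3 rho V b d a.
  by apply: dis => //=; rewrite !inE negb_or bd (eq_sym b) ab (eq_sym d) ad.
have dbe : disjoint3 rho V a c e by apply: dis => //=; rewrite !inE negb_or ac ae ce.
have dbe' : disjoint3 rho V b c e by apply: dis => //=; rewrite !inE negb_or bc be ce.
(* Conjugation by [al] replaces the leg [a] of [be'] by [b]. *)
have comm : tricycle rho V a b c = al * be' * al^-1 * be'^-1.
  rewrite (@tricycleJ _ _ rho al V a c e b c e) // ?tricycleV ?tricycleM4 //.
    by apply: sV => //; apply/eqP; rewrite eq_sym.
  have [tb td ta tout] := tricycleP cV dal.
  move=> y Vy; split; first exact: ta.
    by apply: tout => w Vw; split; apply: sV => //; apply/eqP; rewrite // eq_sym.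
  by apply: tout => w Vw; split; apply: sV => //; apply/eqP; rewrite // eq_sym.
have supp i j k : i \in E -> j \in E -> k \in E -> disjoint3 rho V i j k ->
    supported U (g * tricycle rho V i j k * g^-1).
  move=> iE jE kE dV y nU; have [_ _ _ tout] := tricycleP cV dV.
  rewrite !homeoME tout ?homeoKV // => w Vw.
  by split=> yw; apply: nU; rewrite -(homeoKV g y) yw; apply: VU.
have [Aal Abe] : A al /\ A be' by split; apply: tricycle_alt.
have sA := alt_subgroup rho; have AV k := @subgroupV _ A k sA.
have Ag1 := AV _ Ag.
pose a1 := g * al^-1 * g^-1; pose b1 := g * be' * g^-1.
have s1 : supported U a1.
  by rewrite (_ : a1 = (g * al * g^-1)^-1);
    [apply/supportedV/supp|rewrite !invgM invgK mulgA].
have s2 : supported U b1 by apply: supp.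
have AM k l : A k -> A l -> A (k * l) by apply: subgroupM.
have Aa1 : A a1 by apply: (AM) => //; apply: (AM) => //; apply: AV.
have Ab1 : A b1 by apply: (AM) => //; apply: AM.
have := double_commutator hU s1 s2 => /=; set k := _ * a1^-1 => kE.
have Hk : H k.
  rewrite /k -mulgA -mulgA; apply: subgroupM => //.
  rewrite mulgA; apply: nH => //; exact: subgroupV.
have : H (k * b1 * k^-1 * b1^-1).
  rewrite -mulgA -mulgA; apply: subgroupM => //.
  rewrite mulgA; apply: nH => //; exact: subgroupV.
rewrite kE => /(nH g^-1 _ Ag1).
rewrite (_ : _ * _ * _ = al * be' * al^-1 * be'^-1) -?comm //.
by rewrite /a1 /b1 !invgM !invgK !mulgA !mulgKV !mulVg !mul1g.
Qed.

End Dynamics.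

(** * Finite generation of the alternating full group *)

Section FiniteGeneration.
Variables (Lambda : groupType) (X : topologicalType).
Variable rho : {multiplicative Lambda -> homeo X}.
Hypothesis X_cantor : is_cantor_space X.
Hypothesis rho_minimal : minimal_action rho.
Implicit Types (U V W N : set X) (x y z : X) (a b c d e s u v w : Lambda).
Implicit Types (g h : homeo X) (H : set (homeo X)) (t q : seq Lambda).

Local Notation A := (alternating_full_group rho).

Lemma fin_gen_ind : fin_gen Lambda -> exists Ss : seq Lambda,
  (forall s, s \in Ss -> s^-1 \in Ss) /\
  forall P : Lambda -> Prop, P 1 ->
    (forall s a, s \in Ss -> P a -> P (s * a)) -> forall a, P a.
Proof.
move=> [S /finite_seqP[ss ->] genS].
exists (ss ++ [seq s^-1 | s <- ss]); split=> [s|P P1 PM].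
  rewrite !mem_cat => /orP[sin|/mapP[s' sin ->]]; last by rewrite invgK sin.
  by rewrite (map_f (fun s : Lambda => s^-1)) ?orbT.
pose H := [set g | (forall a, P a -> P (g * a)) /\ (forall a, P a -> P (g^-1 * a))].
have sH : subgroup H.
  apply: subgroup_intro => [|g h [g1 g2] [h1 h2]|g [g1 g2]].
  - by split=> a; rewrite ?invg1 mul1g.
  - by split=> a Pa; rewrite ?invgM -mulgA; [apply/g1/h1|apply/h2/g2].
  - by split=> a; rewrite ?invgK; [apply: g2|apply: g1].
suff HT : [set: Lambda] `<=` H.
  by move=> a; have [/(_ 1 P1)] := HT a I; rewrite mulg1.
rewrite -genS; apply: generated_sub => // s sin; split=> a; apply: PM.
  by rewrite mem_cat sin.
by rewrite mem_cat (map_f (fun s : Lambda => s^-1)) ?orbT.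
Qed.

(** Any cover by clopen sets of diameter less than the expansiveness constant
    will do; this is the coding of the action as a subshift. *)
Lemma expansive_separating (R : realType) : expansive_action rho R ->
  exists qs : seq (set X), (forall Q, Q \in qs -> clopen Q) /\
    forall x y, x <> y -> exists a, exists2 Q, Q \in qs &
      Q (rho a x) /\ ~ Q (rho a y).
Proof.
move=> [dist [[d0 d00 dC dT] dnbhs] [delta delta0 expa]].
pose small V (_ : unit) := forall y z, V y -> V z -> (dist y z < delta)%R.
have [|qs [qsP cov _]] := @cantor_partition _ X_cantor unit small.
  move=> x; exists tt.
  have [|N [cN Nx] Nd] := @cantor_clopen_basis _ X_cantor x
      [set y | (dist x y < delta / 2)%R].
    by apply/dnbhs; exists (delta / 2)%R; rewrite ?Num.Theory.divr_gt0 ?Num.Theory.ltr0n.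
  exists N => // V cV VN y z /VN/Nd/= xy /VN/Nd/= xz.
  apply: (Order.POrderTheory.le_lt_trans (dT y x z)).
  by rewrite (dC y x) [ltRHS](Num.Theory.splitr delta) Num.Theory.ltrD.
exists [seq p.1 | p <- qs]; split=> [Q /mapP[p /qsP[cp _] ->]//|x y xy].
have [a dxy] := expa x y xy; have [p pin px] := cov (rho a x).
exists a, p.1; first exact: map_f.
split=> // py; have [_ /(_ _ _ px py)] := qsP p pin.
by rewrite Order.TotalTheory.ltNge dxy.
Qed.

Lemma fresh_legs x (zs : seq X) k : uniq zs -> exists2 t, size t = k &
  uniq (zs ++ [seq rho a x | a <- t]).
Proof.
elim: k zs => [|k IHk] zs uzs; first by exists [::]; rewrite ?cats0.
have [a _ az] := orbit_avoiding X_cantor rho_minimal x zs openT (I : setT x).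
have [|t tk ut] := IHk (rcons zs (rho a x)); first by rewrite rcons_uniq az.
by exists (a :: t); rewrite /= ?tk // -cat_rcons.
Qed.

Lemma separated_uniq U t x : separated rho U t -> uniq t -> U x ->
  uniq [seq rho a x | a <- t].
Proof.
move=> sU ut Ux; rewrite map_inj_in_uniq // => a b aE bE /= xab.
by have [//|/eqP ab] := eqVneq a b; case: (sU a b aE bE ab _ _ Ux Ux).
Qed.

(** The combinatorial data of a finite generating set. The legs carried at [y]
    and those carried at [s y] may overlap, and not uniformly in [y]; the
    auxiliary legs on the pieces of [ns s] are separated from both and serve as
    stepping stones between them. *)
Section Core.
Variable Ss : seq Lambda.
Hypothesis SsV : forall s, s \in Ss -> s^-1 \in Ss.
Hypothesis Ss_ind : forall P : Lambda -> Prop, P 1 ->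
  (forall s a, s \in Ss -> P a -> P (s * a)) -> forall a, P a.

Local Notation piece := (set X * seq Lambda)%type.

Variable ps : seq piece.
Hypothesis ps_clopen : forall p, p \in ps -> clopen p.1.
Hypothesis ps_legs : forall p, p \in ps ->
  [/\ size p.2 = 5, uniq p.2, 1 \in p.2 & separated rho p.1 p.2].
Hypothesis ps_cover : forall x, exists2 p, p \in ps & p.1 x.
Hypothesis ps_inj : forall p r x, p \in ps -> r \in ps -> p.1 x -> r.1 x -> p = r.

Variable qs : seq (set X).
Hypothesis qs_clopen : forall Q, Q \in qs -> clopen Q.
Hypothesis qs_sep : forall x y, x <> y ->
  exists a, exists2 Q, Q \in qs & Q (rho a x) /\ ~ Q (rho a y).

Definition source_legs (l : piece * piece * seq Lambda) := l.1.1.2 ++ l.2.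
Definition target_legs s (l : piece * piece * seq Lambda) :=
  [seq a * s | a <- l.1.2.2] ++ l.2.

Definition linking s N (l : piece * piece * seq Lambda) : Prop :=
  [/\ [/\ l.1.1 \in ps, l.1.2 \in ps & size l.2 = 3],
      N `<=` l.1.1.1 /\ (forall y, N y -> l.1.2.1 (rho s y)),
      uniq (source_legs l) /\ separated rho N (source_legs l) &
      uniq (target_legs s l) /\ separated rho N (target_legs s l)].

Variable ns : Lambda -> seq (set X * (piece * piece * seq Lambda)).
Hypothesis ns_clopen : forall s n, n \in ns s -> clopen n.1.
Hypothesis ns_linking : forall s n, n \in ns s -> linking s n.1 n.2.
Hypothesis ns_cover : forall s x, exists2 n, n \in ns s & n.1 x.
Hypothesis ns_inj : forall s n m x,
  n \in ns s -> m \in ns s -> n.1 x -> m.1 x -> n = m.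

Variable H : set (homeo X).
Hypothesis sH : subgroup H.
Hypothesis H_ps : forall p, p \in ps -> all_tricycles rho H p.1 p.2.
Hypothesis H_qs : forall p Q, p \in ps -> Q \in qs ->
  all_tricycles rho H (p.1 `&` Q) p.2.
Hypothesis H_source : forall s n, s \in Ss -> n \in ns s ->
  all_tricycles rho H n.1 (source_legs n.2).
Hypothesis H_target : forall s n, s \in Ss -> n \in ns s ->
  all_tricycles rho H n.1 (target_legs s n.2).

(** These sets form a [Lambda]-invariant Boolean algebra that separates points,
    so every clopen set is [good]. *)
Let good W : Prop :=
  clopen W /\ forall p, p \in ps -> all_tricycles rho H (p.1 `&` W) p.2.

Let goodT : good setT.
Proof. by split=> [|p pin]; [apply: clopenX|rewrite setIT; apply: H_ps]. Qed.

Let good_qs Q : Q \in qs -> good Q.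
Proof. by move=> Qin; split=> [|p pin]; [apply: qs_clopen|apply: H_qs]. Qed.

Let goodI V W : good V -> good W -> good (V `&` W).
Proof.
move=> [cV gV] [cW gW]; split=> [|p pin]; first exact: clopen_setI.
have [p5 up _ sp] := ps_legs pin; have cp := ps_clopen pin.
rewrite setIIr; apply: (@all_tricyclesI _ _ rho H p.1 _ _ p.2 sH cp
  (clopen_setI cp cV) (clopen_setI cp cW) (@subIsetl _ _ _) (@subIsetl _ _ _)
  sp up _ (H_ps pin) (gV _ pin) (gW _ pin)).
by rewrite p5.
Qed.

Let goodC W : good W -> good (~` W).
Proof.
move=> [cW gW]; split=> [|p pin]; first exact: clopen_setC.
move=> a b c aE bE cE uabc; have [_ _ _ sp] := ps_legs pin.
have cp := ps_clopen pin.
have dp := separated_disjoint3 sp aE bE cE uabc.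
have pE : p.1 = (p.1 `&` W) `|` (p.1 `\` W) by rewrite setUIDK.
have dis : (p.1 `&` W) `&` (p.1 `\` W) = set0.
  by rewrite -subset0 => x [[_ Wx] [_]].
have := @tricycleU _ _ rho (p.1 `&` W) (p.1 `\` W) a b c
  (clopen_setI cp cW) (clopen_setD cp cW) dis.
rewrite -pE => /(_ dp) tE.
rewrite -/(p.1 `\` W) -(mulKg (tricycle rho (p.1 `&` W) a b c) (tricycle _ _ _ _ _)) -tE.
apply: subgroupM => //; last exact: H_ps.
by apply: subgroupV => //; apply: gW.
Qed.

(** The base is first cut down to the piece [n] by an intersection; the legs are
    then exchanged for the auxiliary ones, and these for the legs at [s y]. *)
Let good_linked s n W : good W -> s \in Ss -> n \in ns s ->
  all_tricycles rho H (n.1 `&` W) (source_legs n.2) /\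
  all_tricycles rho H (n.1 `&` W) (target_legs s n.2).
Proof.
move=> [cW gW] sS nin; have cn := ns_clopen nin.
have [[p1 p2 q3] [np1 np2] [u1 s1] [u2 s2]] := ns_linking nin.
have [p15 up1 _ sp1] := ps_legs p1; have [p25 _ _ _] := ps_legs p2.
have cnW := clopen_setI cn cW; have snW := @subIsetl _ n.1 W.
set p := n.2.1.1 in p1 np1 p15 up1 sp1 *; set q := n.2.2 in q3.
have subp : {subset p.2 <= source_legs n.2} by move=> a ap; rewrite mem_cat ap.
have Hp : all_tricycles rho H (n.1 `&` W) p.2.
  have -> : n.1 `&` W = (p.1 `&` W) `&` n.1.
    by apply/seteqP; split=> x [] => [nx Wx|[_ Wx] nx]; do ![split=> //]; apply: np1.
  have cp := ps_clopen p1.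
  have Hn : all_tricycles rho H n.1 p.2.
    by move=> a b c /subp aE /subp bE /subp cE; apply: (H_source sS nin).
  apply: (@all_tricyclesI _ _ rho H p.1 _ _ p.2 sH cp (clopen_setI cp cW) cn
    (@subIsetl _ _ _) np1 sp1 up1 _ (H_ps p1) (gW _ p1) Hn).
  by rewrite p15.
have Hsource : all_tricycles rho H (n.1 `&` W) (source_legs n.2).
  move: (up1) (p15) (Hp) (subp).
  case: p.2 => [|a [|b [|c l]]] // /(take_uniq 3) + _ Hl subl.
  rewrite -[take 3 _]/[:: a, b, c & take 0 l] take0 => ul.
  apply: (@all_tricycles_spread _ _ rho H n.1 (n.1 `&` W) _ a b c) => //.
  - by rewrite size_cat p15.
  - exact: H_source sS nin.
  - by apply: subl; rewrite !inE eqxx.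
  - by apply: subl; rewrite !inE eqxx ?orbT.
  - by apply: subl; rewrite !inE eqxx ?orbT.
  by apply: Hl; rewrite ?inE ?eqxx ?orbT.
split=> //.
have subq1 : {subset q <= source_legs n.2}.
  by move=> a aq; rewrite mem_cat aq orbT.
have subq2 : {subset q <= target_legs s n.2}.
  by move=> a aq; rewrite mem_cat aq orbT.
have uq : uniq q by move: u1; rewrite cat_uniq => /and3P[].
move: uq q3 subq1 subq2; case: q => [|a [|b [|c [|]]]] // uq _ subq1 subq2.
have [aq bq cq] : [/\ a \in [:: a; b; c], b \in [:: a; b; c] & c \in [:: a; b; c]].
  by rewrite !inE !eqxx !orbT.
apply: (@all_tricycles_spread _ _ rho H n.1 (n.1 `&` W) _ a b c) => //; do ?exact: subq2.
- by rewrite size_cat size_map p25.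
- exact: H_target sS nin.
by apply: Hsource; rewrite ?subq1.
Qed.

Let good_shift W s : good W -> s \in Ss -> good [set x | W (rho s^-1 x)].
Proof.
move=> gW sS; have cW := gW.1; split=> [|p pin]; first exact: clopen_preim.
move=> a b c aE bE cE uabc; have [_ _ _ sp] := ps_legs pin.
pose V := [set y | p.1 (rho s y)] `&` W.
have cV : clopen V.
  by apply: clopen_setI => //; apply/clopen_preim/ps_clopen.
have dV : disjoint3 rho V (a * s) (b * s) (c * s).
  have [ab ac bc] := separated_disjoint3 sp aE bE cE uabc.
  by split=> y z [py _] [pz _]; rewrite !rhoME; [apply: ab|apply: ac|apply: bc].
have -> : p.1 `&` [set x | W (rho s^-1 x)] = [set x | V (rho s^-1 x)].
  by apply/seteqP; split=> x [px Wx]; split=> //; move: px; rewrite /= rhoKV.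
rewrite tricycle_shift //.
pose P V' := V' `<=` V -> H (tricycle rho V' (a * s) (b * s) (c * s)).
suff : P V by apply.
apply: (@partition_glue _ _ (ns s) P V _ _ cV (@ns_clopen s) (ns_cover s) (@ns_inj s)).
- by move=> _; rewrite tricycle0; apply: subgroup1.
- move=> U U' cU cU' UU0 PU PU' UUV.
  rewrite tricycleU //; last exact: disjoint3S UUV dV.
  by apply: subgroupM => //; [apply: PU => x Ux|apply: PU' => x Ux];
    apply: UUV; [left|right].
move=> n nin _; have [[_ p2 _] [_ np2] _ _] := ns_linking nin.
have [np|npn] := eqVneq n.2.1.2 p; last first.
  rewrite (_ : V `&` n.1 = set0) ?tricycle0; first exact: subgroup1.
  rewrite -subset0 => y [[py _] ny]; move/eqP: npn; apply.
  by apply: ps_inj p2 pin (np2 y ny) py.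
have -> : V `&` n.1 = n.1 `&` W.
  apply/seteqP; split=> y [] => [[_ Wy] ny|ny Wy] //.
  by split=> //; split=> //; rewrite -np; apply: np2.
have [_ Ht] := good_linked gW sS nin.
apply: Ht; rewrite ?mem_cat /target_legs ?np.
- by rewrite (map_f (fun a => a * s)).
- by rewrite (map_f (fun a => a * s)).
- by rewrite (map_f (fun a => a * s)).
by rewrite (@map_inj_uniq _ _ (fun a => a * s) (mulIg s) [:: a; b; c]).
Qed.

Let good_orbit W a : good W -> good [set x | W (rho a x)].
Proof.
move: a W; apply: (Ss_ind (P := fun a => forall W, good W -> good [set x | W (rho a x)])).
  move=> W; rewrite (_ : [set _ | _] = W) //.
  by apply/seteqP; split=> x /=; rewrite rho1E.
move=> s a sS IHa W gW; have := good_shift gW (SsV sS); rewrite invgK => /IHa.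
by rewrite /= (_ : [set _ | _] = [set x | W (rho (s * a) x)]) //;
  apply/seteqP; split=> x /=; rewrite rhoME.
Qed.

Let good_clopen V : clopen V -> good V.
Proof.
move=> cV.
have good0 : good set0 by rewrite -setCT; apply: goodC.
have goodU U W : good U -> good W -> good (U `|` W).
  by move=> gU gW; rewrite -(setCK (U `|` W)) setCU; apply/goodC/goodI; apply: goodC.
have loc x : V x -> exists J, [/\ good J, J x & J `<=` V].
  move=> Vx.
  pose P U := exists J, [/\ good J, J x & forall y, J y -> U y -> V y].
  suff /(_ setT)[|J [gJ Jx JV]] : forall U, clopen U -> P U.
  - exact: clopenX.
  - by exists J; split=> // y Jy; apply: JV.
  apply: (cantor_clopen_ind X_cantor).
  - by exists setT; split.
  - move=> U W _ _ _ [J [gJ Jx JU]] [K [gK Kx KW]].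
    exists (J `&` K); split; [exact: goodI|by []|].
    by move=> y [Jy Ky] [/JU|/KW]; apply.
  move=> y; have [yx|yx] := pselect (y = x).
    by exists V; [split; rewrite // yx|move=> U _ UV; exists setT; split=> // z _ /UV].
  have [a [Q Qin [Qx Qy]]] := qs_sep (nesym yx).
  have gQ := good_orbit a (good_qs Qin).
  exists (~` [set z | Q (rho a z)]); first by split=> //; apply: clopen_setC; case: gQ.
  by move=> U _ UQ; exists [set z | Q (rho a z)]; split=> // z Qz /UQ.
pose P U := exists J, [/\ good J, J `<=` V & forall y, U y -> V y -> J y].
suff /(_ setT)[|J [gJ JV VJ]] : forall U, clopen U -> P U.
- exact: clopenX.
- by rewrite (_ : V = J) //; apply/seteqP; split=> // y Vy; apply: VJ.
apply: (cantor_clopen_ind X_cantor).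
- by exists set0; split=> // x [].
- move=> U W _ _ _ [J [gJ JV JU]] [K [gK KV KW]].
  exists (J `|` K); split; [exact: goodU|by move=> y []; [apply: JV|apply: KV]|].
  by move=> y [/JU Jy|/KW Ky] Vy; [left; apply: Jy|right; apply: Ky].
move=> x; have [Vx|nVx] := pselect (V x).
  have [J [gJ Jx JV]] := loc x Vx.
  by exists J; [split=> //; case: gJ|move=> U _ UJ; exists J; split=> // y /UJ].
exists (~` V); first by split=> //; apply: clopen_setC.
by move=> U _ UV; exists set0; split=> // y /UV.
Qed.

(** Legs, not points, have to be followed here: two group elements may agree at
    [x] without agreeing near [x]. *)
Section AtPoint.
Variable x : X.

Let small_tricycles a b c : Prop := uniq [:: rho a x; rho b x; rho c x] /\
  exists2 N, clopen N /\ N x &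
    forall V, clopen V -> V `<=` N -> H (tricycle rho V a b c).

Let full t : Prop := uniq [seq rho a x | a <- t] /\
  forall a b c, a \in t -> b \in t -> c \in t ->
    uniq [:: rho a x; rho b x; rho c x] -> small_tricycles a b c.

Let full_shift U t v : clopen U -> uniq t -> separated rho U t ->
  (forall W, clopen W -> all_tricycles rho H (U `&` W) t) ->
  U (rho v x) -> full [seq a * v | a <- t].
Proof.
move=> cU ut sU HU Uvx; split.
  rewrite -map_comp (eq_map (g := fun a => rho a (rho v x))).
    exact: separated_uniq sU ut Uvx.
  by move=> a /=; rewrite rhoME.
move=> _ _ _ /mapP[a aE ->] /mapP[b bE ->] /mapP[c cE ->] uabc; split=> //.
exists [set y | U (rho v y)]; first by split=> //; apply: clopen_preim.
move=> V cV VU; have u : uniq [:: a; b; c].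
  have := @map_uniq _ _ (fun i => rho (i * v) x) [:: a; b; c]; exact.
have cV' : clopen [set y | V (rho v^-1 y)] by apply: clopen_preim.
rewrite -tricycle_shift //; last first.
  have [ab ac bc] := separated_disjoint3 sU aE bE cE u.
  by split=> y z /VU Uy /VU Uz; rewrite !rhoME; [apply: ab|apply: ac|apply: bc].
have -> : [set y | V (rho v^-1 y)] = U `&` [set y | V (rho v^-1 y)].
  by apply/seteqP; split=> [y Vy|y []//]; split=> //; have := VU _ Vy; rewrite /= rhoKV.
exact: HU.
Qed.

Let small_tricycles_rot a b c : small_tricycles a b c -> small_tricycles b c a.
Proof.
move=> [u [N [cN Nx] NH]]; split; first by rewrite -(rot_uniq 2) /rot /=.
have [M [cM Mx] sM] := @separated_near _ _ rho X_cantor x [:: a; b; c] u.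
have u' := @map_uniq _ _ (fun i => rho i x) [:: a; b; c] u.
exists (N `&` M); first by split=> //; apply: clopen_setI.
move=> V cV VNM; rewrite tricycle_rot //.
  by apply: NH => // y /VNM[].
have sV := sM V cV (fun y Vy => (VNM y Vy).2).
by apply: separated_disjoint3 sV _ _ _ u'; rewrite !inE eqxx ?orbT.
Qed.

(** Conjugation by a 3-cycle [u -> u' -> z], where [z] is a further leg of [t]
    off [a] and [b]: this is where five legs are needed. *)
Let small_tricycles_move t a b u u' : small_tricycles a b u -> full t -> (5 <= size t)%N ->
  u \in t -> u' \in t -> rho u' x \notin [:: rho a x; rho b x] -> small_tricycles a b u'.
Proof.
move=> [uabu [N1 [cN1 N1x] H1]] [ut ft] t5 uin u'in u'ab.
have [E|neq] := eqVneq (rho u x) (rho u' x).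
  suff <- : u = u' by split=> //; exists N1.
  apply/eqP; rewrite -(nth_index 1 uin) -(nth_index 1 u'in) in E *.
  move/eqP: E; rewrite -!(nth_map 1 x (fun a => rho a x)) ?index_mem //.
  by rewrite nth_uniq ?size_map ?index_mem // => /eqP ->.
have [|_ /mapP[z zt ->]] := @fresh_leg _ [seq rho a x | a <- t]
   [:: rho a x; rho b x; rho u x; rho u' x] ut.
  by rewrite size_map.
rewrite !inE !negb_or => /and4P[za zb zu zu'].
move: u'ab; rewrite !inE negb_or => /andP[ua ub].
move: (uabu); rewrite /= !inE negb_or andbT => /andP[/andP[ab au] bu].
have u5 : uniq [seq rho i x | i <- [:: a; b; u; u'; z]].
  rewrite /= !inE !negb_or !(eq_sym _ (rho u' x)) !(eq_sym _ (rho z x)).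
  by rewrite ab au ua za bu ub zb (eq_sym (rho u' x) (rho u x)) neq zu zu'.
have [_ [N2 [cN2 N2x] H2]] : small_tricycles u u' z.
  apply: ft => //; rewrite /= !inE negb_or neq !(eq_sym _ (rho z x)).
  by rewrite zu zu'.
have [N3 [cN3 N3x] s3] := separated_near X_cantor u5.
split; first by rewrite /= !inE negb_or ab !(eq_sym _ (rho u' x)) ua ub.
exists (N1 `&` (N2 `&` N3)); first by split; [do !apply: clopen_setI|].
move=> V cV VN; have sV := s3 V cV (fun y Vy => (VN y Vy).2.2).
have u5' := map_uniq u5.
have [aE bE uE uE' zE] : [/\ a \in [:: a; b; u; u'; z], b \in [:: a; b; u; u'; z],
   u \in [:: a; b; u; u'; z], u' \in [:: a; b; u; u'; z] & z \in [:: a; b; u; u'; z]].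
  by rewrite !inE !eqxx !orbT.
move: u5'; rewrite /= !inE !negb_or !andbT.
move=> /andP[/and4P[ab' au' auu' az'] /andP[/and3P[bu' buu' bz'] /andP[/andP[uu' uz'] uz'']]].
have dV (i j k : Lambda) : i \in [:: a; b; u; u'; z] -> j \in [:: a; b; u; u'; z] ->
    k \in [:: a; b; u; u'; z] -> i != j -> i != k -> j != k -> disjoint3 rho V i j k.
  move=> iE jE kE ij ik jk; apply: separated_disjoint3 sV _ _ _ _ => //.
  by rewrite /= !inE negb_or ij ik jk.
have d2 := dV u u' z uE uE' zE uu' uz' uz''.
have [tu _ _ tout] := tricycleP cV d2.
rewrite -(@tricycleJ _ _ rho (tricycle rho V u u' z) V a b u a b u') //; do ?exact: dV.
  have h2 : H (tricycle rho V u u' z) by apply: H2 => // y /VN[_ []].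
  have h1 : H (tricycle rho V a b u) by apply: H1 => // y /VN[].
  by apply: subgroupM => //; [apply: subgroupM|apply: subgroupV].
move=> y Vy; split; last exact: tu.
  by apply: tout => w Vw; split; apply: sV => //; apply/eqP; rewrite // eq_sym.
by apply: tout => w Vw; split; apply: sV => //; apply/eqP; rewrite // eq_sym.
Qed.

Let full_ps p v : p \in ps -> p.1 (rho v x) -> full [seq a * v | a <- p.2].
Proof.
move=> pin pvx; have [_ up _ sp] := ps_legs pin.
apply: (full_shift (ps_clopen pin) up sp) pvx => W cW.
by have [_] := good_clopen cW; apply.
Qed.

Let fresh_in t a b v : uniq [seq rho i x | i <- [seq i * v | i <- t]] ->
  (2 < size t)%N -> exists2 i, i \in t & rho (i * v) x \notin [:: rho a x; rho b x].
Proof.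
move=> ut t3; have [|_ /mapP[_ /mapP[i it ->] ->] ni] :=
  @fresh_leg _ _ [:: rho a x; rho b x] ut; first by rewrite !size_map.
by exists i.
Qed.

(** Walking along a word in the generators, the third leg can be moved
    anywhere: consecutive steps share at least three legs, and [a] and [b]
    block at most two of them. *)
Let small_tricycles_reach a b u c : small_tricycles a b u -> rho c x \notin [:: rho a x; rho b x] ->
  small_tricycles a b c.
Proof.
move=> Eabu cab.
pose Q w := exists2 p, p \in ps & p.1 (rho (w * u) x) /\
  exists2 i, i \in p.2 & small_tricycles a b (i * (w * u)).
have QT w : Q w.
  move: w; apply: Ss_ind.
    have [p pin pu] := ps_cover (rho u x); exists p => //.
    have [_ _ p1 _] := ps_legs pin.
    by rewrite mul1g; split=> //; exists 1; rewrite ?mul1g.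
  move=> s w sS [p pin [pv [i ip Ei]]]; set v := w * u in pv Ei.
  have [n nin nv] := ns_cover s (rho v x).
  have [[p1 p2 q3] [np1 np2] [u1 s1] [u2 s2]] := ns_linking nin.
  have pE : n.2.1.1 = p by apply: ps_inj p1 pin (np1 _ nv) pv.
  have [p15 _ _ _] := ps_legs p1; have [p25 up2 _ sp2] := ps_legs p2.
  have cn := ns_clopen nin.
  have f1 : full [seq i * v | i <- source_legs n.2].
    apply: (full_shift cn u1 s1) nv => W cW.
    by have [] := good_linked (good_clopen cW) sS nin.
  have f2 : full [seq i * v | i <- target_legs s n.2].
    apply: (full_shift cn u2 s2) nv => W cW.
    by have [] := good_linked (good_clopen cW) sS nin.
  have [||j jq jab] := @fresh_in n.2.2 a b v; last 1 first.
  - have Ej : small_tricycles a b (j * v).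
      apply: small_tricycles_move Ei f1 _ _ _ jab.
      + by rewrite size_map size_cat p15.
      + by apply: (map_f (fun i => i * v)); rewrite mem_cat pE ip.
      + by apply: (map_f (fun i => i * v)); rewrite mem_cat jq orbT.
    have vp2 : n.2.1.2.1 (rho (s * v) x) by rewrite rhoME; apply: np2.
    have [uf _] := full_ps p2 vp2.
    have [||k kp kab] := @fresh_in n.2.1.2.2 a b (s * v) => //.
      by rewrite p25.
    exists n.2.1.2 => //; rewrite -mulgA -/v; split=> //; exists k => //.
    apply: small_tricycles_move Ej f2 _ _ _ kab.
    + by rewrite size_map size_cat size_map p25.
    + by apply: (map_f (fun i => i * v)); rewrite mem_cat jq orbT.
    + rewrite mulgA; apply: (map_f (fun i => i * v)).
      by rewrite mem_cat (map_f (fun i => i * s)).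
  - by case: f1; rewrite /source_legs !map_cat cat_uniq => /and3P[].
  - by rewrite q3.
have [p pin [pc [i ip Ei]]] := QT (c * u^-1).
rewrite mulgKV in pc Ei; have [p5 _ p1 _] := ps_legs pin.
apply: small_tricycles_move Ei (full_ps pin pc) _ _ _ cab.
- by rewrite size_map p5.
- exact: (map_f (fun i => i * c)).
- by rewrite -{1}(mul1g c); apply: (map_f (fun i => i * c)).
Qed.

(** The legs of a known triple are first moved to fresh points, so that replacing
    them by [a], [b] and [c] one at a time never creates a coincidence. *)
Lemma small_tricycles_all a b c : uniq [:: rho a x; rho b x; rho c x] -> small_tricycles a b c.
Proof.
move=> uabc.
have [u [v [w Euvw]]] : exists u v w, small_tricycles u v w.
  have [p pin px] := ps_cover x; have [p5 up _ sp] := ps_legs pin.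
  have [] : full [seq a * 1 | a <- p.2] by apply: full_ps => //; rewrite rho1E.
  move: p5 => {up sp}.
  case: p.2 => [|u [|v [|w t]]] // _ /(take_uniq 3) + ft.
  rewrite -[take 3 _]/[:: rho (u * 1) x, rho (v * 1) x, rho (w * 1) x & take 0 _].
  rewrite take0 => ut.
  by exists (u * 1), (v * 1), (w * 1); apply: ft; rewrite ?inE ?eqxx ?orbT.
have step u1 u2 u3 f1 f2 f3 : small_tricycles u1 u2 u3 ->
    uniq [:: rho f1 x; rho f2 x; rho f3 x] ->
    rho f1 x \notin [:: rho u1 x; rho u2 x] -> rho f2 x != rho u2 x ->
    small_tricycles f1 f2 f3.
  move=> Eu uf f1u f2u; move: uf.
  rewrite /= !inE negb_or andbT => /andP[/andP[f12 f13] f23].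
  have E1 := small_tricycles_rot (small_tricycles_reach Eu f1u).
  have E2 : small_tricycles u2 f1 f2.
    by apply: small_tricycles_reach E1 _; rewrite !inE negb_or f2u eq_sym.
  apply: (small_tricycles_reach (small_tricycles_rot E2)).
  by rewrite !inE negb_or !(eq_sym (rho f3 x)) f13 f23.
have [[|f1 [|f2 [|f3 []]]] // _] := @fresh_legs x
  (undup [:: rho u x; rho v x; rho a x; rho b x]) 3 (undup_uniq _).
rewrite cat_uniq => /and3P[_ nf uf].
have avoid i : i \in [:: u; v; a; b] ->
    rho f1 x != rho i x /\ rho f2 x != rho i x.
  move=> iin; have ii : rho i x \in undup [:: rho u x; rho v x; rho a x; rho b x].
    by rewrite mem_undup; apply: (map_f (fun i => rho i x) iin).
  by split; apply: contra nf => /eqP E; apply/hasP; exists (rho i x); rewrite // -E !inE eqxx ?orbT.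
have [f1u f2u] := avoid u (mem_head _ _).
have [f1v f2v] : rho f1 x != rho v x /\ rho f2 x != rho v x.
  by apply: avoid; rewrite !inE eqxx orbT.
have [f1a f2a] : rho f1 x != rho a x /\ rho f2 x != rho a x.
  by apply: avoid; rewrite !inE eqxx !orbT.
have [f1b f2b] : rho f1 x != rho b x /\ rho f2 x != rho b x.
  by apply: avoid; rewrite !inE eqxx !orbT.
apply: (step f1 f2 f3) => //.
- by apply: (step u v w) => //; rewrite !inE negb_or f1u.
- by rewrite !inE negb_or !(eq_sym (rho a x)) f1a.
by rewrite eq_sym.
Qed.

End AtPoint.

Lemma linked_pieces_generate : A `<=` H.
Proof.
by apply: (alt_sub_of_small X_cantor sH) => x a b c /small_tricycles_all[].
Qed.

End Core.
Let tricycles_over (d : set X * seq Lambda) : seq (homeo X) :=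
  [seq tricycle rho d.1 ab.1 ab.2 c | ab <- [seq (a, b) | a <- d.2, b <- d.2],
                                      c <- d.2].

Let all_tricycles_over H (d : set X * seq Lambda) :
  (forall g, g \in tricycles_over d -> H g) -> all_tricycles rho H d.1 d.2.
Proof.
move=> Hd a b c aE bE cE _; apply: Hd; apply/allpairsP; exists ((a, b), c).
by split=> //; apply/allpairsP; exists (a, b).
Qed.

(** Near each point, five legs are chosen with distinct values, and for each
    generator [s] three further legs off those chosen at [y] and at [s y];
    compactness makes these choices finite in number. *)
Lemma alt_fin_gen (R : realType) : fin_gen Lambda -> expansive_action rho R ->
  exists gs : seq (homeo X), (forall g, g \in gs -> A g) /\
    forall H, subgroup H -> (forall g, g \in gs -> H g) -> A `<=` H.
Proof.
move=> /fin_gen_ind[Ss [SsV Ss_ind]] /expansive_separating[qs [cqs qs_sep]].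
pose legs V t := [/\ size t = 5, uniq t, 1 \in t & separated rho V t].
have [|ps [psP ps_cov ps_inj]] := @cantor_partition _ X_cantor _ legs.
  move=> x; have [//|t t4 ut] := @fresh_legs x [:: x] 4.
  have u : uniq [seq rho a x | a <- 1 :: t] by rewrite /= rho1E.
  have [N Nx sN] := separated_near X_cantor u.
  exists (1 :: t), N => // V cV VN; split; rewrite ?mem_head //= ?t4 //.
    exact: map_uniq u.
  exact: sN.
have ps_clopen p (pin : p \in ps) := (psP p pin).1.
have ps_legs p (pin : p \in ps) := (psP p pin).2.
have /choice[ns nsP] s : exists ns : seq (set X * _),
    [/\ forall n, n \in ns -> clopen n.1 /\ linking ps s n.1 n.2,
        forall x, exists2 n, n \in ns & n.1 x &
        forall n m x, n \in ns -> m \in ns -> n.1 x -> m.1 x -> n = m].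
  apply: (cantor_partition X_cantor) => y.
  have [p1 p1in p1y] := ps_cov y; have [p2 p2in p2y] := ps_cov (rho s y).
  have [p15 u1 _ s1] := ps_legs p1 p1in; have [p25 u2 _ s2] := ps_legs p2 p2in.
  pose z1 := [seq rho a y | a <- p1.2].
  pose z2 := [seq rho a y | a <- [seq a * s | a <- p2.2]].
  have [q q3] := @fresh_legs y (undup (z1 ++ z2)) 3 (undup_uniq _).
  rewrite cat_uniq => /and3P[_ /hasPn qz uq].
  have us : uniq [seq rho a y | a <- p1.2 ++ q].
    rewrite map_cat cat_uniq uq (separated_uniq s1) //= andbT.
    by apply/hasPn => z /qz; rewrite mem_undup mem_cat negb_or => /andP[].
  have ut : uniq [seq rho a y | a <- [seq a * s | a <- p2.2] ++ q].
    rewrite map_cat cat_uniq uq andbT; apply/andP; split.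
      rewrite -map_comp (eq_map (g := fun a => rho a (rho s y))).
        exact: separated_uniq p2y.
      by move=> a /=; rewrite rhoME.
    by apply/hasPn => z /qz; rewrite mem_undup mem_cat negb_or => /andP[].
  have [N1 [cN1 N1y] H1] := separated_near X_cantor us.
  have [N2 [cN2 N2y] H2] := separated_near X_cantor ut.
  exists (p1, p2, q).
  exists ((N1 `&` N2) `&` (p1.1 `&` [set x | p2.1 (rho s x)])).
    split=> //; apply: clopen_setI; apply: clopen_setI => //.
      exact: ps_clopen.
    by apply/clopen_preim/ps_clopen.
  move=> V cV VN; split=> //=.
  - by split=> x /VN[_ []].
  - by split; [apply: map_uniq us|apply: H1 => // x /VN[[]]].
  - by split; [apply: map_uniq ut|apply: H2 => // x /VN[[]]].
pose ds : seq (set X * seq Lambda) := ps ++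
  [seq (p.1 `&` Q, p.2) | p <- ps, Q <- qs] ++
  flatten [seq [seq (n.1, source_legs n.2) | n <- ns s] ++
               [seq (n.1, target_legs s n.2) | n <- ns s] | s <- Ss].
exists (flatten (map tricycles_over ds)); split=> [g|H sH Hgs].
  by move=> /flatten_mapP[d _ /allpairsP[abc [_ _ ->]]]; apply: tricycle_alt.
have Hds (d : set X * seq Lambda) : d \in ds -> all_tricycles rho H d.1 d.2.
  move=> din; apply: all_tricycles_over => g gd; apply: Hgs.
  by apply/flatten_mapP; exists d.
apply: (@linked_pieces_generate Ss SsV Ss_ind ps ps_clopen ps_legs ps_cov ps_inj qs cqs
  qs_sep ns) => //.
- by move=> s n; have [+ _ _] := nsP s => /(_ n) + nin => /(_ nin)[].
- by move=> s n; have [+ _ _] := nsP s => /(_ n) + nin => /(_ nin)[].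
- by move=> s x; have [_ + _] := nsP s; apply.
- by move=> s; have [_ _ +] := nsP s; apply.
- by move=> p pin; apply: Hds; rewrite mem_cat pin.
- move=> p Q pin Qin; apply: (Hds (p.1 `&` Q, p.2)).
  by rewrite !mem_cat; apply/orP; right; apply/orP; left; apply/allpairsP; exists (p, Q).
- move=> s n sS nin; apply: (Hds (n.1, source_legs n.2)).
  rewrite !mem_cat; apply/orP; right; apply/orP; right.
  apply/flatten_mapP; exists s => //; rewrite mem_cat; apply/orP; left.
  by apply/mapP; exists n.
- move=> s n sS nin; apply: (Hds (n.1, target_legs s n.2)).
  rewrite !mem_cat; apply/orP; right; apply/orP; right.
  apply/flatten_mapP; exists s => //; rewrite mem_cat; apply/orP; right.
  by apply/mapP; exists n.
Qed.

End FiniteGeneration.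

(** * Commensurated subgroups of the alternating full group *)

Section Commensurated.
Variables (Lambda : groupType) (X : topologicalType).
Variable rho : {multiplicative Lambda -> homeo X}.
Hypothesis X_cantor : is_cantor_space X.
Hypothesis rho_minimal : minimal_action rho.
Implicit Types (U V W N : set X) (x y z : X).
Implicit Types (a e g h k l m s : homeo X) (H M : set (homeo X)).

Local Notation A := (alternating_full_group rho).

Let A1 : A 1. Proof. exact: subgroup1 (alt_subgroup rho). Qed.
Let AM g h : A g -> A h -> A (g * h).
Proof. exact: subgroupM (alt_subgroup rho). Qed.
Let AV g : A g -> A g^-1. Proof. exact: subgroupV (alt_subgroup rho). Qed.

Variable gs : seq (homeo X).
Hypothesis gs_alt : forall g, g \in gs -> A g.
Hypothesis gs_gen :
  forall H, subgroup H -> (forall g, g \in gs -> H g) -> A `<=` H.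

Let gsV := gs ++ [seq g^-1 | g <- gs].

Let gsV_alt g : g \in gsV -> A g.
Proof.
by rewrite mem_cat => /orP[/gs_alt//|/mapP[k /gs_alt/AV Ak ->]].
Qed.

Let alt_word_ind (P : homeo X -> Prop) : P 1 ->
  (forall a s, A a -> s \in gsV -> P a -> P (a * s)) -> forall a, A a -> P a.
Proof.
move=> P1 PM.
pose H := [set g | A g /\ forall a, A a -> P a -> P (a * g) /\ P (a * g^-1)].
have sH : subgroup H.
  apply: subgroup_intro => [|g h [Ag gP] [Ah hP]|g [Ag gP]].
  - by split=> // a _; rewrite invg1 mulg1.
  - split=> [|a Aa Pa]; first exact: AM.
    rewrite invgM !mulgA; split.
      by apply: (hP _ (AM Aa Ag) (gP _ Aa Pa).1).1.
    by apply: (gP _ (AM Aa (AV Ah)) (hP _ Aa Pa).2).2.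
  - by split=> [|a Aa Pa]; [apply: AV|rewrite invgK; case: (gP a Aa Pa)].
have AH : A `<=` H.
  apply: gs_gen => // g gin; split=> [|a Aa Pa]; first exact: gs_alt.
  split; apply: PM => //; rewrite mem_cat ?gin //.
  by rewrite (map_f (fun g : homeo X => g^-1)) ?orbT.
by move=> a Aa; have [_ /(_ 1 A1 P1)[]] := AH a Aa; rewrite mul1g.
Qed.

(** The elements all of whose conjugates lie in [H] form a normal subgroup, to
    which simplicity applies. *)
Let core_trivial H h : subgroup H -> ~ A `<=` H ->
  (forall g, A g -> H (g * h * g^-1)) -> h = 1.
Proof.
move=> sH nAH Hh; apply: contrapT => h1; apply: nAH.
pose C := [set k | forall g, A g -> H (g * k * g^-1)].
have AC : A `<=` C.
  apply: (alt_simple X_cantor rho_minimal (h := h)) => //.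
    apply: subgroup_intro => [g Ag|k l Ck Cl g Ag|k Ck g Ag].
    - by rewrite mulg1 mulgV; apply: subgroup1.
    - rewrite (_ : _ * _ * _ = (g * k * g^-1) * (g * l * g^-1)).
        by apply: subgroupM => //; [apply: Ck|apply: Cl].
      by rewrite !mulgA mulgKV.
    - rewrite (_ : _ * _ * _ = (g * k * g^-1)^-1).
        by apply: subgroupV => //; apply: Ck.
      by rewrite !invgM invgK mulgA.
  move=> g k Ag Ck g' Ag'; have := Ck _ (AM Ag' Ag).
  by rewrite invgM !mulgA.
by move=> k /AC /(_ 1 A1); rewrite mul1g invg1 mulg1.
Qed.

Let alt_moving V x : clopen V -> V x ->
  exists a, [/\ A a, supported V a & a x <> x].
Proof.
move=> cV Vx; have [W [cW W0 WV /(_ x (mem_head _ _)) Wx]] :=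
  clopen_avoiding X_cantor [:: x] cV.1 Vx.
have [a [Aa sa Wa]] := alt_move X_cantor rho_minimal cV Vx cW.1 W0 WV.
by exists a; split=> // ax; apply: Wx; rewrite -ax.
Qed.

Variable L : set (homeo X).
Hypothesis sL : subgroup L.
Hypothesis LA : L `<=` A.
Hypothesis comL : forall a, A a -> fin_cover L (L `&` Defs.conjugate a L).

Let openJ a M : A a -> open_in L M ->
  open_in L (M `&` [set x | M (a^-1 * x * a)]).
Proof. exact: open_in_conj. Qed.

Let openL : open_in L L. Proof. exact: open_in_refl. Qed.

(** Either the topology on [A] defined by [L] is finer than the uniform topology
    of [X] (first alternative), or its small open subgroups are topologically
    transitive: a pair of distinct limit points of the graphs of small elements
    can be moved anywhere, because [A] acts 2-transitively up to closure. *)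
Definition uniformly_small : Prop := forall U, clopen U ->
  exists2 M, open_in L M & forall h x, M h -> U (h x) <-> U x.

Definition locally_transitive : Prop := forall V W M, open V -> V !=set0 ->
  open W -> W !=set0 -> open_in L M -> exists2 h, M h & exists2 x, V x & W (h x).

Lemma uniform_or_transitive : uniformly_small \/ locally_transitive.
Proof.
have [|/existsNP[U /not_implyP[cU nU]]] := pselect uniformly_small; [by left|right].
have leave M : open_in L M -> exists h x, [/\ M h, U x & ~ U (h x)].
  move=> oM; have sM : subgroup M by case: oM.
  apply: contrapT => nh; apply: nU; exists M => // h x Mh; split=> [Uhx|Ux].
    apply: contrapT => nUx; apply: nh; exists h^-1, (h x).
    by rewrite homeoK; split=> //; apply: subgroupV.
  by apply: contrapT => nUhx; apply: nh; exists h, x.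
have [x0 [y0 [Ux0 Uy0 lim]]] : exists x0 y0, [/\ U x0, ~ U y0 &
    forall N1 N2 M, clopen N1 -> N1 x0 -> clopen N2 -> N2 y0 -> open_in L M ->
      exists2 h, M h & exists2 x, N1 x & N2 (h x)].
  apply: contrapT => nlim.
  have sep x y : U x -> ~ U y -> exists N1 N2 M,
      [/\ clopen N1 /\ N1 x, clopen N2 /\ N2 y, open_in L M &
          forall h z, M h -> N1 z -> ~ N2 (h z)].
    move=> Ux nUy; apply: contrapT => nsep; apply: nlim; exists x, y; split=> //.
    move=> N1 N2 M cN1 N1x cN2 N2y oM; apply: contrapT => nh; apply: nsep.
    exists N1, N2, M; split=> // h z Mh N1z N2hz.
    by apply: nh; exists h => //; exists z.
  pose P V := exists2 M, open_in L M & forall h z, M h -> V z -> U z -> U (h z).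
  suff /(_ setT)[|M oM MU] : forall V, clopen V -> P V.
  - exact: clopenX.
  - by have [h [x [Mh Ux]]] := leave M oM; apply; apply: MU.
  apply: (cantor_clopen_ind X_cantor).
  - by exists L => // h z _ [].
  - move=> V W _ _ _ [M oM MV] [M' oM' MW].
    exists (M `&` M'); first exact: open_inI.
    by move=> h z [Mh M'h] [Vz|Wz]; [apply: MV|apply: MW].
  move=> x; have [Ux|nUx] := pselect (U x); last first.
    exists (~` U); first by split=> //; apply: clopen_setC.
    by move=> V _ VU; exists L => // h z _ /VU.
  pose Q W := exists N M, [/\ clopen N /\ N x, open_in L M &
    forall h z, M h -> N z -> W (h z) -> U (h z)].
  suff /(_ setT)[|N [M [cN oM MU]]] : forall W, clopen W -> Q W.
  - exact: clopenX.
  - by exists N => // V _ VN; exists M => // h z Mh /VN Nz _; apply: MU.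
  apply: (cantor_clopen_ind X_cantor).
  - by exists setT, L; split=> //; split=> //; apply: clopenX.
  - move=> V W _ _ _ [N [M [[cN Nx] oM MV]]] [N' [M' [[cN' N'x] oM' MW]]].
    exists (N `&` N'), (M `&` M'); split; [|exact: open_inI|].
      by split=> //; apply: clopen_setI.
    by move=> h z [Mh M'h] [Nz N'z] [|]; [apply: MV|apply: MW].
  move=> y; have [Uy|nUy] := pselect (U y).
    exists U => // W _ WU; exists setT, L; split=> //.
      by split=> //; apply: clopenX.
    by move=> h z _ _ /WU.
  have [N1 [N2 [M [cN1 cN2 oM MN]]]] := sep x y Ux nUy.
  exists N2 => // W _ WN; exists N1, M; split=> // h z Mh Nz /WN N2hz.
  by case: (MN h z Mh Nz).
move=> V W M oV V0 oW W0 oM.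
have [|g [Ag Vg Wg]] := @alt_2transitive _ _ rho X_cantor rho_minimal x0 y0 V W _ oV V0 oW W0.
  by move=> xy; apply: Uy0; rewrite -xy.
have [V' [cV' V'g] V'V] := cantor_clopen_basis X_cantor (open_nbhs_nbhs (conj oV Vg)).
have [W' [cW' W'g] W'W] := cantor_clopen_basis X_cantor (open_nbhs_nbhs (conj oW Wg)).
have oM' := openJ (AV Ag) oM.
have [h [_ Mh] [x V'x W'x]] := lim _ _ _ (clopen_preim g cV') V'g
  (clopen_preim g cW') W'g oM'.
exists (g * h * g^-1); first by move: Mh; rewrite /= invgK.
by exists (g x); [apply: V'V|rewrite !homeoME homeoK; apply: W'W].
Qed.

Section Transitive.
Hypothesis tr : locally_transitive.
Hypothesis nAL : ~ A `<=` L.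

(** Conjugates of [g] by small elements are close to [g]; by transitivity they
    can be chosen to fix an open subset of any given open set. *)
Let approx g V M : A g -> open V -> V !=set0 -> open_in L M ->
  exists V', [/\ open V', V' !=set0, V' `<=` V &
    exists2 e, A e & (forall x, V' x -> e x = x) /\ M (g^-1 * e)].
Proof.
pose P := [set g | A g /\ forall V M, open V -> V !=set0 -> open_in L M ->
  exists V', [/\ open V', V' !=set0, V' `<=` V &
    exists2 e, A e & (forall x, V' x -> e x = x) /\ M (g^-1 * e)]].
have sP : subgroup P.
  apply: subgroup_intro => [|{}g h [Ag gP] [Ah hP]|{}g [Ag gP]].
  - split=> // {}V {}M oV V0 oM; exists V; split=> //; exists 1 => //.
    by split=> //; rewrite mulg1 invg1; apply: subgroup1; case: oM.
  - split=> [|{}V {}M oV V0 oM]; first exact: AM.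
    have [V1 [oV1 V10 V1V [e1 Ae1 [e1V [_ Me1]]]]] := gP V _ oV V0 (openJ Ah oM).
    have [V2 [oV2 V20 V2V [e2 Ae2 [e2V Me2]]]] := hP V1 M oV1 V10 oM.
    exists V2; split=> // [x /V2V /V1V //|]; exists (e1 * e2); first exact: AM.
    split=> [x V2x|]; first by rewrite homeoME e2V // e1V //; apply: V2V.
    rewrite (_ : _ * _ = (h^-1 * (g^-1 * e1) * h) * (h^-1 * e2)).
      by apply: subgroupM => //; case: oM.
    by rewrite invgM !mulgA mulgK.
  - split=> [|{}V {}M oV V0 oM]; first exact: AV.
    have [V1 [oV1 V10 V1V [e Ae [eV [_ Me]]]]] :=
      gP V _ oV V0 (openJ (AV Ag) oM).
    exists V1; split=> //; exists e^-1; first exact: AV.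
    split=> [x V1x|]; first exact/homeo_inv_fix/eV.
    rewrite invgK (_ : g * e^-1 = (g * (g^-1 * e) * g^-1)^-1).
      by apply: subgroupV; [case: oM|move: Me; rewrite /= invgK].
    by rewrite mulVKg invgM invgK.
suff AP : A `<=` P by move=> /AP[_]; apply.
apply: (alt_sub_of_small X_cantor sP) => x a b c uabc.
have [y _] := cantor_open_infinite X_cantor [:: rho a x; rho b x; rho c x] openT
  (I : setT x).
move=> yabc.
have [|V0 [cV0 V0y] V0abc] := @local_clopen_all X _
    [:: rho a x; rho b x; rho c x] (fun z V => ~ V z) y.
  move=> z zin; have [yz|U [cU Uy Uz]] := @cantor_clopen_sep _ X_cantor y z.
    by move: yabc; rewrite yz zin.
  by exists U => // U' _ UU /UU.
have {}V0abc := V0abc V0 cV0 (fun _ => id).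
have [N [cN Nx] sN] := @separated_near _ _ rho X_cantor x [:: a; b; c] uabc.
have u := @map_uniq _ _ (fun i => rho i x) [:: a; b; c] uabc.
pose off (i : Lambda) := [set z | ~ V0 (rho i z)].
have coff i : clopen (off i) by apply/clopen_setC/clopen_preim.
exists (N `&` (off a `&` (off b `&` off c))).
  split; first by do !apply: clopen_setI.
  by do !split=> //; apply: V0abc; rewrite !inE eqxx ?orbT.
move=> W cW WN; split; first exact: tricycle_alt.
set t := tricycle rho W a b c.
have tV0 z : V0 z -> t z = z.
  move=> V0z; have sW := sN W cW (fun w Ww => (WN w Ww).1).
  have dW : disjoint3 rho W a b c.
    by apply: separated_disjoint3 sW _ _ _ u; rewrite !inE eqxx ?orbT.
  have [_ _ _ tout] := tricycleP cW dW; apply: tout => w /WN[_ [oa [ob oc]]].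
  by split=> zw; [apply: oa|apply: ob|apply: oc]; rewrite -zw.
have At : A t by apply: tricycle_alt.
move=> {}V {}M oV VN0 oM.
have [|h [Mh Mth] [z V0z Vhz]] := tr cV0.1 _ oV VN0 (openJ At oM).
  by exists y.
exists (V `&` [set w | V0 (h^-1 w)]); split.
- by apply: openI => //; case: (clopen_preim h^-1 cV0).
- by exists (h z); split=> //; rewrite /mkset homeoK.
- by move=> w [].
exists (h * t * h^-1).
  have Ah : A h by apply: LA; case: oM => _ ML _; apply: ML.
  by apply: AM; [apply: AM|apply: AV].
split=> [w [_ V0w]|]; first by rewrite !homeoME tV0 // homeoKV.
rewrite (_ : _ * _ = (t^-1 * h * t) * h^-1); last by rewrite !mulgA.
have sM : subgroup M by case: oM.
by apply: subgroupM => //; apply: subgroupV.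
Qed.

(** For [s] in the generating list, [L s L] is a finite union of cosets [k s L].
    Once each [k s] is approximated by an element fixing [V], words in the
    generators can be rewritten from the left. *)
Let transitive_factor : exists V, [/\ clopen V, V !=set0 &
  forall g, A g -> exists2 e, A e & supported (~` V) e /\ L (e^-1 * g)].
Proof.
have /choice[ks ksP] s : exists ks : seq (homeo X), A s ->
    (forall k, k \in ks -> L k) /\
    forall l, L l -> exists2 k, k \in ks & L (s^-1 * (k^-1 * l) * s).
  have [As|] := pselect (A s); last by exists [::].
  have [_ _ [ks [Lks cov]]] := openJ As openL.
  by exists ks => _; split=> // l /cov[k kks []]; exists k.
pose cs := [seq k * s | s <- gsV, k <- ks s].
have csA c : c \in cs -> A c.
  move=> /allpairsPdep[s [k [/gsV_alt As kks ->]]].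
  by apply: AM => //; apply: LA; case: (ksP s As) => + _; apply.
have [V [oV [v Vv] Vcs]] : exists V, [/\ open V, V !=set0 & forall c, c \in cs ->
    exists2 e, A e & (forall x, V x -> e x = x) /\ L (e^-1 * c)].
  have [x _] : exists x : X, True.
    by case: X_cantor => f [g _]; exists (g (fun=> true)).
  elim: cs csA => [|c cs IHcs] csA; first by exists setT; split=> //; [apply: openT|exists x].
  have [d din|V [oV V0 Vcs]] := IHcs; first by apply: csA; rewrite inE din orbT.
  have [V1 [oV1 V10 V1V [e Ae [eV1 Le]]]] :=
    approx (csA c (mem_head _ _)) oV V0 openL.
  exists V1; split=> // d; rewrite inE => /predU1P[->|/Vcs[e' Ae' [e'V Le']]].
    exists e => //; split=> //; rewrite -[_ * c]invgK invgM invgK.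
    exact: subgroupV.
  by exists e' => //; split=> // z /V1V; apply: e'V.
have [U [cU Uv] UV] := cantor_clopen_basis X_cantor (open_nbhs_nbhs (conj oV Vv)).
exists U; split=> //; first by exists v.
have fixU e : (forall x, V x -> e x = x) -> supported (~` U) e.
  by move=> eV x /contrapT /UV; apply: eV.
apply: alt_word_ind.
  by exists 1 => //; split=> //; rewrite invg1 mul1g; apply: subgroup1.
move=> a s Aa sin [e Ae [eU Le]]; have As := gsV_alt sin.
have [Lks cov] := ksP s As; have [k kks Ls] := cov _ Le.
have [|e' Ae' [e'V Le']] := Vcs (k * s); first by apply/allpairsPdep; exists s, k.
exists (e * e'); first exact: AM.
split; first by apply: supportedM => //; apply: fixU.
rewrite (_ : _ * _ = (e'^-1 * (k * s)) * (s^-1 * (k^-1 * (e^-1 * a)) * s)).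
  exact: subgroupM.
by rewrite invgM !mulgA mulgK mulgK.
Qed.

Lemma not_locally_transitive : False.
Proof.
have [V [cV [x Vx] fac]] := transitive_factor.
have commV e a : supported (~` V) e -> supported V a -> e * a = a * e.
  by apply: supported_commute; rewrite setICl.
(* By the factorisation, the conjugates of [h] under [A] are its conjugates under
   [L]. *)
have free h : L h -> supported V h -> h = 1.
  move=> Lh sh; apply: (core_trivial sL nAL) => g Ag.
  have [e Ae [se Le]] := fac _ (AV Ag).
  rewrite (_ : g * h * g^-1 = (e^-1 * g^-1)^-1 * h * (e^-1 * g^-1)).
    by do 2?apply: subgroupM => //; apply: subgroupV.
  rewrite invgM !invgK -!mulgA; congr (g * _); rewrite !mulgA (commV e h) //.
  by rewrite mulgK.
have [a [Aa sa ax]] := alt_moving cV Vx.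
have [_ _ [ks [Lks cov]]] := openJ Aa openL.
(* Each of the finitely many cosets [k a L] contains at most one conjugate of [a]
   by an element supported in [V]; [o k] is its value at [x]. *)
pose conj_in k g := [/\ A g, supported V g & L ((k * a)^-1 * (g * a * g^-1))].
have conjV g : supported V g -> supported V (g * a * g^-1).
  by move=> sg; do 2?apply: supportedM => //; apply: supportedV.
have /choice[o oP] k : exists z, forall g, conj_in k g -> (g * a * g^-1) x = z.
  have [[g [Ag sg Lg]]|ng] := pselect (exists g, conj_in k g); last first.
    by exists x => g gk; case: ng; exists g.
  exists ((g * a * g^-1) x) => g' [Ag' sg' Lg']; congr (homeo_fun _ x).
  apply: (mulgI (g * a * g^-1)^-1); rewrite mulVg; apply: free.
    rewrite (_ : _ * _ = ((k * a)^-1 * (g * a * g^-1))^-1 *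
      ((k * a)^-1 * (g' * a * g'^-1))).
      by apply: subgroupM => //; apply: subgroupV.
    by rewrite [in RHS]invgM invgK [in RHS]mulgA mulgK.
  by apply: supportedM; [apply: supportedV|]; apply: conjV.
have /cantor_clopen_sep-/(_ X_cantor)[U [cU Uax Ux]] := ax.
have cVU := clopen_setI cV cU.
have Vax : V (a x) by apply: supported_stable.
have [W [cW W0 WVU Wo]] := clopen_avoiding X_cantor [seq o k | k <- ks] cVU.1
  (conj Vax Uax).
have [g [Ag sg Wg]] := alt_move X_cantor rho_minimal cVU (conj Vax Uax) cW.1 W0 WVU.
have sgV : supported V g by apply: supportedS sg => y [].
apply: Wo Wg.
have gx : g^-1 x = x by apply: homeo_inv_fix; apply: sg => -[].
have -> : g (a x) = (g * a * g^-1) x by rewrite !homeoME gx.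
have [e Ae [se Le]] := fac _ (AV Ag).
pose l := (e^-1 * g^-1)^-1; have Ll : L l by apply: subgroupV.
have conjE : g * a * g^-1 = l * a * l^-1.
  have -> : l = g * e by rewrite /l invgM !invgK.
  rewrite invgM -!mulgA; congr (g * _).
  by rewrite !mulgA (commV e a) // mulgK.
have [k kks [_ Lk]] := cov l Ll.
apply/mapP; exists k => //; apply: oP; split=> //.
rewrite conjE (_ : _ * _ = (a^-1 * (k^-1 * l) * a) * l^-1).
  by apply: subgroupM => //; apply: subgroupV.
by rewrite invgM !mulgA.
Qed.

End Transitive.

Section Uniform.
Hypothesis un : uniformly_small.
Hypothesis nAL : ~ A `<=` L.
Hypothesis L_infinite : ~ finite_set L.

(** If [L] met the elements supported in [W] trivially, these would commute with
    small elements of [L]. Elements with this property form a normal subgroup,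
    so all of [A] would commute with an open subgroup of [L]. *)
Let rist_nontrivial W : clopen W -> W !=set0 ->
  exists h, [/\ L h, supported W h & h <> 1].
Proof.
move=> cW [w Ww]; apply: contrapT => nh.
have triv h : L h -> supported W h -> h = 1.
  by move=> Lh sh; apply: contrapT => h1; apply: nh; exists h.
pose C := [set a | A a /\ exists2 M, open_in L M & forall h, M h -> h * a = a * h].
have AC : A `<=` C.
  have [a [Aa sa aw]] := alt_moving cW Ww.
  apply: (alt_simple X_cantor rho_minimal (h := a)).
  - apply: subgroup_intro => [|b c [Ab [M oM Mb]] [Ac [M' oM' Mc]]|b [Ab [M oM Mb]]].
    + by split=> //; exists L => // h _; rewrite mul1g mulg1.
    + split; first exact: AM.
      exists (M `&` M'); first exact: open_inI.
      by move=> h [Mh M'h]; rewrite mulgA Mb // -mulgA Mc // mulgA.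
    + split; first exact: AV.
      exists M => // h Mh; apply: (mulgI b); rewrite mulVKg mulgA -Mb //.
      by rewrite mulgK.
  - move=> g k Ag [Ak [M oM Mk]]; split; first by apply: AM; [apply: AM|apply: AV].
    exists (M `&` [set x | M (g^-1 * x * g)]); first exact: openJ.
    move=> h [_ /= /Mk hk].
    rewrite (_ : h * _ = g * (g^-1 * h * g * k) * g^-1); last by rewrite !mulgA mulgV mul1g.
    by rewrite hk !mulgA mulgK.
  - split=> //; have [M oM MW] := un cW.
    exists (M `&` (L `&` [set x | L (a^-1^-1 * x * a^-1)])).
      by apply: open_inI => //; apply: openJ => //; apply: AV.
    move=> h [Mh [Lh]]; rewrite /= invgK => Lah.
    suff k1 : h * a * h^-1 * a^-1 = 1.
      by have /(congr1 (fun k => k * a * h)) := k1; rewrite mul1g mulgKV mulgKV.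
    apply: triv.
      rewrite (_ : _ * _ = h * (a * h * a^-1)^-1).
        by apply: subgroupM => //; apply: subgroupV.
      by rewrite !invgM invgK !mulgA.
    apply: supportedM; last exact: supportedV.
    apply: (supportedS _ (@supportedJ _ W a h sa)) => y; rewrite /mkset => Wy.
    by rewrite -(homeoKV h y); apply/(MW h).
  - by move=> a1; apply: aw; rewrite a1.
have [M oM Mgs] : exists2 M, open_in L M &
    forall g, g \in gs -> forall h, M h -> h * g = g * h.
  elim: gs gs_alt => [|g s IHs] sA; first by exists L.
  have [g' g's|M oM Ms] := IHs; first by apply: sA; rewrite inE g's orbT.
  have [_ [M' oM' Mg]] := AC g (sA g (mem_head _ _)).
  exists (M `&` M'); first exact: open_inI.
  by move=> g' + h [Mh M'h]; rewrite inE => /predU1P[->|/Ms]; [apply: Mg|apply].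
apply: L_infinite; apply: fin_cover1_finite.
have [_ _ cM] := oM; apply: fin_coverS cM => h Mh.
apply: (alt_centralizer X_cantor rho_minimal) => k Ak; apply/esym.
have := gs_gen (subgroup_centralizer h); apply=> // g gin.
by rewrite /= (Mgs g).
Qed.

(** The closure of [M] in [A] for uniform convergence on [X]; a neighbourhood of
    [g] is described by the preimages of finitely many clopen sets. *)
Let agree g h (Us : seq (set X)) := forall U, U \in Us -> forall x, U (g x) <-> U (h x).

Let uclosure M g : Prop := A g /\ forall Us, (forall U, U \in Us -> clopen U) ->
  exists2 m, M m & agree g m Us.

Let uclosure_sub M : M `<=` A -> M `<=` uclosure M.
Proof. by move=> MA m Mm; split=> [|Us _]; [apply: MA|exists m]. Qed.

Let uclosureM M g h : subgroup M -> uclosure M g -> uclosure M h -> uclosure M (g * h).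
Proof.
move=> sM [Ag gM] [Ah hM]; split=> [|Us cUs]; first exact: AM.
have [m Mm gm] := gM Us cUs.
have [|m' Mm' hm] := hM [seq [set x | U (m x)] | U <- Us].
  by move=> _ /mapP[U /cUs cU ->]; apply: clopen_preim.
exists (m * m'); first exact: subgroupM.
move=> U Uin x; rewrite !homeoME (gm U Uin).
by apply: (hm [set x | U (m x)]); apply/mapP; exists U.
Qed.

Let uclosureV M g : subgroup M -> uclosure M g -> uclosure M g^-1.
Proof.
move=> sM [Ag gM]; split=> [|Us cUs]; first exact: AV.
have [|m Mm gm] := gM [seq [set x | U (g^-1 x)] | U <- Us].
  by move=> _ /mapP[U /cUs cU ->]; apply: clopen_preim.
exists m^-1; first exact: subgroupV.
move=> U Uin x; have := gm [set x | U (g^-1 x)]; rewrite (map_f (fun U => [set x | U (g^-1 x)])) //.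
by move=> /(_ isT (m^-1 x)); rewrite /mkset homeoK homeoKV => ->.
Qed.

Let uclosure_subgroup M : subgroup M -> M `<=` A -> subgroup (uclosure M).
Proof.
move=> sM MA; apply: subgroup_intro => [|g h|g].
- by apply: uclosure_sub => //; apply: subgroup1.
- exact: uclosureM.
- exact: uclosureV.
Qed.

Let uclosure_conj M s g : A s -> (forall m, M m -> L (s^-1 * m * s)) ->
  uclosure M g -> uclosure L (s^-1 * g * s).
Proof.
move=> As Ms [Ag gM]; split=> [|Us cUs]; first by do 2?apply: AM => //; apply: AV.
have [|m Mm gm] := gM [seq [set x | U (s^-1 x)] | U <- Us].
  by move=> _ /mapP[U /cUs cU ->]; apply: clopen_preim.
exists (s^-1 * m * s); first exact: Ms.
move=> U Uin x; rewrite !homeoME.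
by apply: (gm [set x | U (s^-1 x)]); apply/mapP; exists U.
Qed.

(** [U] is preserved by a finite index subgroup of [L], and the closure adds no
    new preimage of [U]. *)
Let finite_orbit U : clopen U -> exists ks : seq (homeo X),
  forall h, uclosure L h -> exists2 k, k \in ks & forall x, U (h x) <-> U (k x).
Proof.
move=> cU; have [M oM MU] := un cU; have [sM _ [ks [_ cov]]] := oM.
exists [seq k^-1 | k <- ks] => h [_ /(_ [:: U])[|l Ll hl]].
  by move=> V; rewrite inE => /eqP ->.
have [k kks Mk] := cov _ (subgroupV sL Ll).
exists k^-1; first by apply/mapP; exists k.
move=> x; rewrite (hl U (mem_head _ _)) -(MU _ (k^-1 x) (subgroupV sM Mk)).
by rewrite !invgM !invgK !homeoME homeoKV.
Qed.

(** Two close points lie on the same side of every set in the finite orbit of [U],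
    hence on the same side of [U] after any element of [A] is applied; this
    contradicts 2-transitivity. *)
Let uclosure_proper : ~ A `<=` uclosure L.
Proof.
move=> AL.
have [x _] : exists x : X, True.
  by case: X_cantor => f [g _]; exists (g (fun=> true)).
have [y _] := cantor_open_infinite X_cantor [:: x] openT (I : setT x).
rewrite inE => /eqP yx.
have [U [cU Uy Ux]] := cantor_clopen_sep X_cantor yx.
have [ks ksP] := finite_orbit cU.
have [|N [cN Nx] Nk] := @local_clopen_all X _ ks
    (fun k V => forall z z', V z -> V z' -> U (k z) -> U (k z')) x.
  move=> k _; have ck := clopen_preim k cU.
  have [Ukx|nUkx] := pselect (U (k x)).
    by exists [set z | U (k z)] => // V _ VU z z' _ /VU.
  exists (~` [set z | U (k z)]); first by split=> //; apply: clopen_setC.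
  by move=> V _ VU z z' /VU.
have [z Nz] := cantor_open_infinite X_cantor [:: x] cN.1 Nx.
rewrite inE => /eqP zx; have cU' := clopen_setC cU.
have [||g [Ag Ugz nUgx]] := alt_2transitive X_cantor rho_minimal zx cU.1 _ cU'.1.
- by exists y.
- by exists x.
have [k kks gk] := ksP g (AL g Ag).
by apply: nUgx; apply/gk/(Nk N cN (fun _ => id) k kks z x Nz Nx)/gk.
Qed.

(** A closed subgroup of finite index is open: the closure of [L] is a finite
    union of cosets of the closure of [L /\ s L s^-1], and [Us] separates [1] from
    those cosets that do not contain it. *)
Let uclosure_conj_open s : A s -> exists Us : seq (set X),
  (forall U, U \in Us -> clopen U) /\
  forall h, uclosure L h -> agree h 1 Us -> uclosure L (s^-1 * h * s).
Proof.
move=> As; have oM := openJ As openL; set M := _ `&` _ in oM.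
have [sM ML [ks [Lks cov]]] := oM; have MA m : M m -> A m by move=> /ML /LA.
have Ms m : M m -> L (s^-1 * m * s) by case.
have kA k : k \in ks -> A k by move=> /Lks /LA.
have uclosure_cover h : uclosure L h -> exists2 k, k \in ks & uclosure M (k^-1 * h).
  move=> [Ah hL]; apply: contrapT => nk.
  have /choice[Vs VsP] k : exists Vs : seq (set X), k \in ks ->
      (forall V, V \in Vs -> clopen V) /\ ~ exists2 m, M m & agree (k^-1 * h) m Vs.
    have [kks|] := boolP (k \in ks); last by exists [::].
    apply: contrapT => nVs; apply: nk; exists k => //.
    split=> [|Vs cVs]; first exact: AM (AV (kA k kks)) Ah.
    by apply: contrapT => nm; apply: nVs; exists Vs.
  have [|l Ll hl] := hL (flatten [seq [seq [set z | V (k^-1 z)] | V <- Vs k] | k <- ks]).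
    move=> _ /flatten_mapP[k kks /mapP[V Vin ->]]; apply: clopen_preim.
    by case: (VsP k kks) => + _; apply.
  have [k kks Mk] := cov l Ll; have [_] := VsP k kks; apply.
  exists (k^-1 * l) => // V Vin x; rewrite !homeoME.
  apply: (hl [set z | V (k^-1 z)]).
  by apply/flatten_mapP; exists k => //; apply/mapP; exists V.
have /choice[Vs VsP] k : exists Vs : seq (set X),
    (forall V, V \in Vs -> clopen V) /\
    (k \in ks -> uclosure M k \/ ~ exists2 m, M m & agree k^-1 m Vs).
  have [ck|nck] := pselect (uclosure M k^-1).
    by exists [::]; split=> // _; left; have := @uclosureV M k^-1 sM ck; rewrite invgK.
  have [kks|nks] := boolP (k \in ks); last first.
    by exists [::]; split=> // kks; rewrite kks in nks.
  apply: contrapT => nVs; apply: nck; split=> [|Vs cVs]; first exact: AV (kA k kks).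
  by apply: contrapT => nm; apply: nVs; exists Vs; split=> // _; right.
exists (flatten [seq [seq [set z | V (k^-1 z)] | V <- Vs k] | k <- ks]).
split=> [_ /flatten_mapP[k kks /mapP[V Vin ->]]|h ch hU].
  by apply: clopen_preim; case: (VsP k) => + _; apply.
have [k kks ckh] := uclosure_cover h ch.
have [cVs /(_ kks)[ck|[]]] := VsP k.
  by apply: (uclosure_conj As Ms); rewrite -(mulVKg k h); apply: uclosureM.
have [_ /(_ _ cVs)[m Mm khm]] := ckh.
exists m => // V Vin x; rewrite -(khm V Vin) homeoME.
suff E : forall x, V (k^-1 (h x)) <-> V (k^-1 x) by apply: iff_sym.
apply: (hU [set z | V (k^-1 z)]).
by apply/flatten_mapP; exists k => //; apply/mapP; exists V.
Qed.

Lemma uniform_compressible : exists U, compressible A U.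
Proof.
have /choice[Us UsP] s : exists Us : seq (set X), A s ->
    (forall U, U \in Us -> clopen U) /\
    forall h, uclosure L h -> agree h 1 Us -> uclosure L (s^-1 * h * s).
  have [As|] := pselect (A s); last by exists [::].
  by have [Us ?] := uclosure_conj_open As; exists Us.
have /choice[ks ksP] U : exists ks : seq (homeo X), clopen U ->
    forall h, uclosure L h -> exists2 k, k \in ks & forall x, U (h x) <-> U (k x).
  have [cU|] := pselect (clopen U); last by exists [::].
  by have [ks ?] := finite_orbit cU; exists ks.
pose Vs := flatten [seq Us s | s <- gsV].
have cVs U : U \in Vs -> clopen U.
  by move=> /flatten_mapP[s /gsV_alt As]; case: (UsP s As) => + _; apply.
pose exits U k := [set x | U x /\ ~ U (k x)].
pose enters U k := [set x | ~ U x /\ U (k x)].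
pose Ws := [seq exits U k | U <- Vs, k <- ks U] ++ [seq enters U k | U <- Vs, k <- ks U].
have oWs W : W \in Ws -> open W.
  rewrite mem_cat => /orP[] /allpairsPdep[U [k [/cVs cU _ ->]]].
    by case: (clopen_setI cU (clopen_setC (clopen_preim k cU))).
  by case: (clopen_setI (clopen_setC cU) (clopen_preim k cU)).
(* [h] agrees with one of finitely many representatives on some [U] that it does
   not preserve, and so moves the points that enter or leave [U]. *)
have moved h s : uclosure L h -> s \in gsV -> ~ uclosure L (s^-1 * h * s) ->
    exists W, [/\ W \in Ws, W !=set0 & forall w, W w -> h w <> w].
  move=> ch sin nch; have As := gsV_alt sin; have [_ sP] := UsP s As.
  have [U Uin [x nUx]] : exists2 U, U \in Us s & exists x, ~ (U (h x) <-> U x).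
    apply: contrapT => nU; apply: nch; apply: sP => // U Uin x.
    by apply: contrapT => nUx; apply: nU; exists U => //; exists x.
  have UVs : U \in Vs by apply/flatten_mapP; exists s.
  have [k kks hk] := ksP U (cVs U UVs) h ch.
  have [Ux|nU] := pselect (U x).
    exists (exits U k); split.
    - by rewrite mem_cat; apply/orP; left; apply/allpairsPdep; exists U, k.
    - by exists x; split=> // /hk Uhx; apply: nUx.
    - by move=> w [Uw nUw] hw; apply: nUw; apply/hk; rewrite hw.
  exists (enters U k); split.
  - by rewrite mem_cat; apply/orP; right; apply/allpairsPdep; exists U, k.
  - by exists x; split=> //; apply/hk; apply: contrapT => nUhx; apply: nUx; split.
  - by move=> w [nUw /hk Uw] hw; apply: nUw; rewrite -hw.
have [x0 _] : exists x : X, True.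
  by case: X_cantor => f [g _]; exists (g (fun=> true)).
apply: contrapT => ncomp.
have [|N [cN Nx0] NW] := @local_clopen_all X _ Ws
    (fun W V => W !=set0 -> ~ exists2 g, A g & g @` W `<=` V) x0.
  move=> W Win; have [W0|nW0] := pselect (W !=set0); last first.
    by exists setT => //; split=> //; apply: clopenX.
  have [V nV VW] : exists2 V, nbhs x0 V & ~ exists2 g, A g & g @` W `<=` V.
    apply: contrapT => nV; apply: ncomp; exists W; split=> //; first exact: oWs.
    exists x0 => V nbV; apply: contrapT => ng; apply: nV; exists V => //.
  have [N [cN Nx0] NV] := cantor_clopen_basis X_cantor nV.
  exists N => // N' _ N'N _ [g Ag gW]; apply: VW; exists g => //.
  by move=> y /gW /N'N /NV.
have {}NW := NW N cN (fun _ => id).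
have [|m [Lm sm m1]] := rist_nontrivial cN; first by exists x0.
have scL := uclosure_subgroup sL LA.
have [g [s [Ag sin cg ncg]]] : exists g s, [/\ A g, s \in gsV,
    uclosure L (g^-1 * m * g) & ~ uclosure L (s^-1 * (g^-1 * m * g) * s)].
  apply: contrapT => ngs; apply: m1; apply: (core_trivial scL uclosure_proper) => a Aa.
  rewrite -{1}[a]invgK; move: {Aa}(AV Aa).
  move: (a^-1); apply: alt_word_ind.
    by rewrite invg1 mul1g mulg1; apply: uclosure_sub.
  move=> b s Ab sin cb; apply: contrapT => nc; apply: ngs; exists b, s; split=> //.
  by move: nc; rewrite invgM !mulgA.
have [W [Win W0 Wm]] := moved _ s cg sin ncg.
apply: (NW W Win W0); exists g => // _ [w Ww <-]; apply: contrapT => nN.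
by apply: (Wm w Ww); rewrite !homeoME sm // homeoK.
Qed.

End Uniform.

Lemma commensurated_alt : (~ exists U, compressible A U) ->
  finite_set L \/ A `<=` L.
Proof.
move=> ncomp; apply: contrapT => /not_orP[Linf nAL].
have [un|tr] := uniform_or_transitive.
  by apply: ncomp; apply: uniform_compressible.
exact: not_locally_transitive tr nAL.
Qed.

End Commensurated.

(** * Reduction to the alternating full group *)

Section ReductionToAlt.
Variables (Lambda : groupType) (X : topologicalType).
Variable rho : {multiplicative Lambda -> homeo X}.
Hypothesis X_cantor : is_cantor_space X.
Hypothesis rho_minimal : minimal_action rho.

Local Notation A := (alternating_full_group rho).

Variables Gamma K : set (homeo X).
Hypothesis Gamma_subgroup : subgroup Gamma.
Hypothesis alt_Gamma : A `<=` Gamma.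
Hypothesis K_subgroup : subgroup K.
Hypothesis K_commensurated : commensurated Gamma K.

Lemma commensurated_fin_cover L a : subgroup L -> L `<=` K -> A a ->
  fin_cover L (L `&` Defs.conjugate a K).
Proof.
move=> sL LK Aa.
have conjP g : subgroup (Defs.conjugate g K).
  rewrite (_ : Defs.conjugate g K = [set x | K (g^-1 * x * g)]).
    exact: subgroup_conj.
  by apply/seteqP; split=> x /conjugateE.
have K1 : Defs.conjugate 1 K = K.
  by apply/seteqP; split=> x; [move=> /conjugateE|move=> Kx; apply/conjugateE];
    rewrite invg1 mul1g mulg1.
have [] := K_commensurated (subgroup1 Gamma_subgroup) (alt_Gamma Aa).
rewrite K1 => fi _.
have := finite_index_cover (subgroupI K_subgroup (conjP a)) LK sL fi.
by apply: fin_coverS => x [Lx [_ cx]].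
Qed.

(** For [s] in [A], the commutators of [s] with elements of [K] close to the
    identity lie in [K `&` A]. If that group is finite, a finite index subgroup
    of [K] centralises [s]; the centraliser of [A] is trivial. *)
Lemma finite_of_finite_trace (gs : seq (homeo X)) :
  (forall g, g \in gs -> A g) ->
  (forall H : set (homeo X), subgroup H -> (forall g, g \in gs -> H g) -> A `<=` H) ->
  K `<=` full_group rho -> finite_set (K `&` A) -> finite_set K.
Proof.
move=> gs_alt gs_gen K_full /finite_seqP[fs fsE].
have centr s : A s -> open_in K (K `&` [set x | x * s = s * x]).
  move=> As; split; [|by move=> x []|].
    exact/subgroupI/subgroup_centralizer.
  pose M := K `&` [set x | K (s * x * s^-1)].
  have As' : A s^-1 by apply: subgroupV As; apply: alt_subgroup.
  have cM : fin_cover K M.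
    have := commensurated_fin_cover K_subgroup (fun _ => id) As'.
    by apply: fin_coverS => x [Kx /conjugateE]; rewrite invgK.
  apply: fin_cover_trans cM _ => //; first by move=> x [].
  apply: (@fin_cover_color _ _ fs (fun x c => s * (x * s^-1 * x^-1) = c)).
    move=> x [Kx Kx']; exists (s * (x * s^-1 * x^-1)) => //.
    suff : [set` fs] (s * (x * s^-1 * x^-1)) by [].
    rewrite -fsE; split.
      by rewrite !mulgA; apply: subgroupM => //; apply: subgroupV.
    apply: subgroupM As _; first exact: alt_subgroup.
    by apply: (alt_normal_full X_cantor) => //; apply: K_full.
  move=> x y c [Kx _] [Ky _] <- /mulgI xy; split.
    by apply: subgroupM => //; apply: subgroupV.
  have E : s^-1 * (x^-1 * y) = x^-1 * y * s^-1.
    have := congr1 (fun g => x^-1 * g * y) xy.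
    by rewrite !mulgA mulVg mul1g mulgKV.
  by rewrite /mkset; apply: (mulgI s^-1); rewrite mulKg mulgA E mulgKV.
have [M [sM _ cM] Mgs] : exists2 M, open_in K M &
    forall g, g \in gs -> forall h, M h -> h * g = g * h.
  elim: gs gs_alt {gs_gen} => [|g s IHs] sA.
    by exists K => //; apply: open_in_refl.
  have [g' g's|M oM Ms] := IHs; first by apply: sA; rewrite inE g's orbT.
  exists (M `&` (K `&` [set x | x * g = g * x])).
    exact: open_inI oM (centr g (sA g (mem_head _ _))).
  by move=> g' + h [Mh [_ hg]]; rewrite inE => /predU1P[->//|/Ms]; apply.
apply: fin_cover1_finite; apply: fin_coverS cM => h Mh.
apply: (alt_centralizer X_cantor rho_minimal) => k Ak; apply/esym.
have := gs_gen _ (subgroup_centralizer h); apply=> // g gin.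
by rewrite /= (Mgs g).
Qed.

End ReductionToAlt.

Local Close Scope group_scope.

Theorem theorem6p4 (R : realType) (Lambda : groupType) (X : topologicalType)
    (rho : {multiplicative Lambda -> homeo X})
    (Lambda_fg : fin_gen Lambda)
    (X_cantor : is_cantor_space X)
    (rho_minimal : minimal_action rho)
    (rho_expansive : expansive_action rho R)
    (no_compressible :
       ~ exists U : set X, compressible (alternating_full_group rho) U)
    (Gamma : set (homeo X))
    (Gamma_subgroup : subgroup Gamma)
    (Gamma_full : Gamma `<=` full_group rho)
    (alt_Gamma : alternating_full_group rho `<=` Gamma)
    (K : set (homeo X))
    (K_subgroup : subgroup K)
    (K_Gamma : K `<=` Gamma)
    (K_commensurated : commensurated Gamma K) :
  finite_set K \/ alternating_full_group rho `<=` K.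
Proof.
have [gs [gs_alt gs_gen]] :=
  alt_fin_gen X_cantor rho_minimal Lambda_fg rho_expansive.
have sA := alt_subgroup rho.
pose L := K `&` alternating_full_group rho.
have sL : subgroup L by apply: subgroupI.
have comL a : alternating_full_group rho a ->
    fin_cover L (L `&` Defs.conjugate a L).
  move=> Aa; have LK : L `<=` K by move=> x [].
  have := commensurated_fin_cover Gamma_subgroup alt_Gamma K_subgroup
    K_commensurated sL LK Aa.
  apply: fin_coverS => x [Lx /conjugateE Kx]; split=> //; apply/conjugateE.
  split=> //; apply: (subgroupM sA) => //; apply: (subgroupM sA); last by case: Lx.
  exact: subgroupV sA Aa.
have LA : L `<=` alternating_full_group rho by move=> x [].
have [Lfin|AL] := commensurated_alt X_cantor rho_minimal gs_alt gs_gen sL LA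
  comL no_compressible; last by right=> x /AL[].
have K_full : K `<=` full_group rho by move=> x /K_Gamma /Gamma_full.
left; exact: (finite_of_finite_trace X_cantor rho_minimal Gamma_subgroup alt_Gamma
  K_subgroup K_commensurated gs_alt gs_gen K_full Lfin).
Qed.
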